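(* Let $X$ be a diffusion as in the context, with local time $L$ at $0$ and Lévy measure $\nu$ of the inverse local time satisfying the subexponentiality assumption (A). Then for any fixed $\ell>0$, $$\lim_{t\to+\infty}\frac{\mathbf{P}_0(L_t\le \ell)}{\ell\,\nu((t,+\infty))}=1 .$$
   Context: Setting. $X$ is a linear regular recurrent diffusion taking values in $\mathbb{R}_+=[0,\infty)$, with $0$ an instantaneously reflecting boundary and $+\infty$ a natural boundary. $\mathbf{P}_x$ and $\mathbf{E}_x$ are the probability measure and expectation when $X$ starts from $x\ge 0$. $X$ is defined on the canonical space of continuous functions $\omega:\mathbb{R}_+\to\mathbb{R}_+$. $m$ is the speed measure and $S$ the scale function of $X$ (generator $\frac{d}{dm}\frac{d}{dS}$); $S$ is normalized by $S(0)=0$, $S(+\infty)=+\infty$ by recurrence, and $m$ has no atoms. $p(t;x,y)$ is the jointly continuous symmetric transition density of $X$ with respect to $m$, i.e. $\mathbf{P}_x(X_t\in A)=\int_A p(t;x,y)\,m(dy)$, and $R_\lambda(x,y)=\int_0^\infty e^{-\lambda t}p(t;x,y)\,dt$ for $\lambda>0$. Local time. $L_t$ is the local time of $X$ at $0$, normalized by $L_t=\lim_{\delta\downarrow0}\frac{1}{m((0,\delta))}\int_0^t \mathbf{1}_{[0,\delta)}(X_s)\,ds$. Its right-continuous inverse $\tau_\ell:=\inf\{s:L_s>\ell\}$, $\ell\ge0$, is a subordinator under $\mathbf{P}_0$ (without drift), and its Lévy measure $\nu$ is given by $$\mathbf{E}_0(e^{-\lambda\tau_\ell})=\exp(-\ell/R_\lambda(0,0))=\exp\Big(-\ell\int_0^\infty(1-e^{-\lambda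 v})\,\nu(dv)\Big).$$ Assumption (A). The probability distribution function $x\mapsto \nu((1,x])/\nu((1,+\infty))$, $x>1$ (equal to $0$ for $x\le1$), is subexponential. Here a distribution function $F$ on $(0,\infty)$ with $F(0+)=0$, $F(x)<1$ for all $x>0$, $\lim_{x\to\infty}F(x)=1$ is subexponential if $\lim_{x\to\infty}\overline{F*F}(x)/\overline F(x)=2$, with $\overline F=1-F$ and $*$ convolution. *)

(* Defs.v *)
From HB Require Import structures.
From mathcomp Require Import all_boot all_order all_algebra.
From mathcomp Require Import all_classical all_reals all_analysis.
From mathcomp Require Import measurable_realfun.

Set Implicit Arguments.
Unset Strict Implicit.
Unset Printing Implicit Defensive.

Import Order.TTheory GRing.Theory Num.Theory.
Import numFieldNormedType.Exports.

Local Open Scope classical_set_scope.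
Local Open Scope ring_scope.

(* Canonical path space C(R_+, R_+).  A path is stored as a function on the
   whole line, constant on the negative half-line, so that each element of
   C(R_+, R_+) is represented exactly once. *)
Record cpath (R : realType) := CPath {
  cpath_fun :> R -> R ;
  cpath_cont : continuous cpath_fun ;
  cpath_ge0 : forall t : R, 0 <= cpath_fun t ;
  cpath_neg : forall t, t <= 0 -> cpath_fun t = cpath_fun 0 }.

HB.instance Definition _ (R : realType) := gen_eqMixin (cpath R).
HB.instance Definition _ (R : realType) := gen_choiceMixin (cpath R).

Definition cpath0 (R : realType) : cpath R :=
  @CPath R (fun=> 0) (@cst_continuous _ _ 0) (fun=> lexx 0)
    (fun _ _ => erefl).

HB.instance Definition _ (R : realType) := isPointed.Build (cpath R) (cpath0 R).

Lemma shift_cont (R : realType) (s : R) (w : cpath R) :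
  continuous (fun t : R => w (s + Num.max t 0)).
Proof.
move=> t; apply: (@continuous_comp R R R (fun t : R => s + Num.max t 0) w).
  apply: (@continuousD _ _ _ (fun=> s) (fun t : R => Num.max t 0)).
    exact: cst_continuous.
  apply: (@continuous_max _ _ id (fun=> 0)).
    exact: cvg_id.
  exact: cst_continuous.
exact: cpath_cont.
Qed.

Lemma shift_neg (R : realType) (s : R) (w : cpath R) (t : R) :
  t <= 0 -> w (s + Num.max t 0) = w (s + Num.max 0 0).
Proof. by move=> t0; rewrite maxxx (max_idPr t0). Qed.

Definition shift (R : realType) (s : R) (w : cpath R) : cpath R :=
  @CPath R (fun t : R => w (s + Num.max t 0)) (@shift_cont R s w)
    (fun t => cpath_ge0 w _) (@shift_neg R s w).

Definition cylinders (R : realType) (I : set R) : set (set (cpath R)) :=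
  [set E | exists s, I s /\ exists B : set R,
    measurable B /\ E = [set w : cpath R | B (w s)]].

Definition pathspace (R : realType) := g_sigma_algebraType (@cylinders R `[0, +oo[).

(* F^0_t = sigma(X_s, s <= t). *)
Definition history (R : realType) (t : R) : set (set (pathspace R)) :=
  <<s @cylinders R `[0, t] >>.

(* Stopping times of the right-continuous filtration (F^0_{t+}), and their
   sigma-algebras F^0_{T+}. *)
Definition optional_time (R : realType) (T : pathspace R -> \bar R) : Prop :=
  (forall w, (0 <= T w)%E) /\
  (forall t : R, 0 < t -> history t [set w | (T w < t%:E)%E]).

Definition before (R : realType) (T : pathspace R -> \bar R)
    (A : set (pathspace R)) : Prop :=
  measurable A /\
  (forall t : R, 0 < t -> history t (A `&` [set w | (T w < t%:E)%E])).

Definition hit (R : realType) (y : R) (w : pathspace R) : \bar R :=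
  ereal_inf [set t%:E | t in [set t : R | 0 <= t /\ (w : cpath R) t = y]].

(* In everything below, only the values P x with x >= 0 are meaningful. *)
Record strong_markov (R : realType) (P : R -> probability (pathspace R) R) :
    Prop := {
  markov_start : forall x : R, 0 <= x ->
    P x [set w : pathspace R | (w : cpath R) 0 = x] = 1%E ;
  markov_kernel : forall B, measurable B ->
    measurable_fun (`[0, +oo[ : set R) (fun x => P x B) ;
  markov_strong : forall (T : pathspace R -> \bar R) (A B : set (pathspace R)) (x : R),
    optional_time T -> before T A -> measurable B -> 0 <= x ->
    P x (A `&` [set w | (T w < +oo)%E]
           `&` [set w | B (shift (fine (T w)) w)]) =
    (\int[P x]_(w in A `&` [set w | T w < +oo])
       P ((w : cpath R) (fine (T w))) B)%E }.

Definition regular (R : realType) (P : R -> probability (pathspace R) R) : Prop :=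
  forall x y : R, 0 <= x -> 0 <= y -> (0 < P x [set w | hit y w < +oo])%E.

Definition recurrent (R : realType) (P : R -> probability (pathspace R) R) : Prop :=
  forall x y : R, 0 <= x -> 0 <= y -> P x [set w | (hit y w < +oo)%E] = 1%E.

(* The values of S on the negative half-line are irrelevant; taking S in
   [cumulative R R] gives access to its Stieltjes measure dS. *)
Record scale_function (R : realType) (P : R -> probability (pathspace R) R)
    (S : cumulative R R) : Prop := {
  scale_cont : {within `[0, +oo[, continuous S} ;
  scale_incr : forall x y : R, 0 <= x -> x < y -> S x < S y ;
  scale_0 : S 0 = 0 ;
  scale_y : S x @[x --> +oo] --> +oo ;
  scale_hit : forall a x b : R, 0 <= a -> a < x -> x < b ->
    P x [set w | (hit a w < hit b w)%E] = ((S b - S x) / (S b - S a))%:E }.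

Definition bounded_continuous (R : realType) (f : R -> R) : Prop :=
  {within `[0, +oo[, continuous f} /\
  exists C : R, forall x : R, 0 <= x -> `|f x| <= C.

Definition difference_quotient (R : realType)
    (P : R -> probability (pathspace R) R) (f : R -> R) (t x : R) : R :=
  (\int[P x]_w f ((w : cpath R) t) - f x) / t.

(* (f, g) is in the graph of the generator of the semigroup of X acting on
   C_b(R_+), the convergence being bounded and pointwise. *)
Definition generator (R : realType) (P : R -> probability (pathspace R) R)
    (f g : R -> R) : Prop :=
  [/\ bounded_continuous f, bounded_continuous g,
      exists C : R, forall t x : R, 0 < t -> 0 <= x ->
        `|difference_quotient P f t x| <= C
    & forall x : R, 0 <= x -> difference_quotient P f t x @[t --> 0^'+] --> g x].

(* df/dS (x) = d; at x = 0 this is a right derivative. *)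
Definition has_scale_derivative (R : realType) (S f : R -> R) (x d : R) : Prop :=
  (f y - f x) / (S y - S x) @[y --> within (`[0, +oo[ : set R) x^'] --> d.

(* (d/dm)(d/dS) f = g on R_+ with the reflecting condition df/dS (0) = 0. *)
Definition dmdS (R : realType) (S : R -> R)
    (m : {measure set R -> \bar R}) (f g : R -> R) : Prop :=
  [/\ bounded_continuous f, bounded_continuous g
    & exists D : R -> R,
      [/\ D 0 = 0,
          forall x : R, 0 <= x -> has_scale_derivative S f x (D x)
        & forall a b : R, 0 <= a -> a <= b ->
            D b - D a = \int[m]_(y in `]a, b]) g y]].

(* m is finite near 0 and S(0) is finite, so that 0 is a non-singular boundary;
   it is instantaneous because m {0} = 0, and reflecting because of the boundary
   condition in [dmdS]. *)
Record speed_measure (R : realType) (P : R -> probability (pathspace R) R)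
    (S : cumulative R R)
    (m : {measure set R -> \bar R}) : Prop := {
  speed_neg : m `]-oo, 0[%classic = 0%E ;
  speed_noatom : forall x : R, m [set x] = 0%E ;
  speed_fin : forall b : R, (m `[0%R, b]%classic < +oo)%E ;
  speed_pos : forall a b : R, 0 <= a -> a < b -> (0 < m `]a, b[%classic)%E ;
  speed_generator : forall f g, generator P f g <-> dmdS S m f g }.

(* Feller's test: +oo is neither an exit nor an entrance boundary. *)
Definition natural_at_infty (R : realType) (S : cumulative R R)
    (m : {measure set R -> \bar R}) : Prop :=
  forall z : R, 0 < z ->
    (\int[lebesgue_stieltjes_measure S]_(a in `]z, +oo[) m `]z, a[%classic = +oo)%E /\
    (\int[m]_(a in `]z, +oo[) (S a - S z)%:E = +oo)%E.

Record recurrent_reflected_diffusion (R : realType)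
    (P : R -> probability (pathspace R) R) (S : cumulative R R)
    (m : {measure set R -> \bar R}) : Prop := {
  diffusion_markov : strong_markov P ;
  diffusion_regular : regular P ;
  diffusion_recurrent : recurrent P ;
  diffusion_scale : scale_function P S ;
  diffusion_speed : speed_measure P S m ;
  diffusion_natural : natural_at_infty S m }.

Record transition_density (R : realType) (P : R -> probability (pathspace R) R)
    (m : {measure set R -> \bar R}) (p : R -> R -> R -> R) :
    Prop := {
  density_ge0 : forall t x y : R, 0 < t -> 0 <= x -> 0 <= y -> 0 <= p t x y ;
  density_cont :
    {within [set z : R * R * R | [/\ 0 < z.1.1, 0 <= z.1.2 & 0 <= z.2]],
      continuous (fun z : R * R * R => p z.1.1 z.1.2 z.2)} ;
  density_sym : forall t x y : R, 0 < t -> 0 <= x -> 0 <= y -> p t x y = p t y x ;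
  densityE : forall (t x : R) (A : set R), 0 < t -> 0 <= x ->
    measurable A -> A `<=` `[0, +oo[ ->
    P x [set w : pathspace R | A ((w : cpath R) t)] =
    (\int[m]_(y in A) (p t x y)%:E)%E }.

Definition resolvent (R : realType) (p : R -> R -> R -> R) (lam x y : R) : R :=
  \int[@lebesgue_measure R]_(t in `]0, +oo[) (expR (- (lam * t)) * p t x y).

(* The limit determines L up to indistinguishability only; L is a version all
   of whose trajectories are continuous and nondecreasing. *)
Record local_time_at0 (R : realType) (P : R -> probability (pathspace R) R)
    (m : {measure set R -> \bar R})
    (L : R -> pathspace R -> R) : Prop := {
  local_time_meas : forall t : R, 0 <= t -> measurable_fun setT (L t) ;
  local_time_0 : forall w, L 0 w = 0 ;
  local_time_cont : forall w, {within `[0, +oo[, continuous (L ^~ w)} ;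
  local_time_ndecr : forall w (s t : R), 0 <= s -> s <= t -> L s w <= L t w ;
  local_time_lim : forall x : R, 0 <= x ->
    {ae P x, forall w : pathspace R, forall t : R, 0 <= t ->
      (\int[@lebesgue_measure R]_(s in `[0, t])
         \1_(`[0, delta[ : set R) ((w : cpath R) s)) / fine (m `]0, delta[%classic)
        @[delta --> 0^'+] --> L t w} }.

Definition inverse_local_time (R : realType) (L : R -> pathspace R -> R)
    (l : R) (w : pathspace R) : \bar R :=
  ereal_inf [set s%:E | s in [set s : R | 0 <= s /\ l < L s w]].

(* E_0 (e^(-lam tau_l)), with e^(-oo) = 0. *)
Definition inverse_local_time_laplace (R : realType)
    (P : R -> probability (pathspace R) R) (L : R -> pathspace R -> R)
    (l lam : R) : \bar R :=
  (\int[P 0%R]_w expeR (- (lam%:E * inverse_local_time L l w)))%E.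

Record inverse_local_time_levy_measure (R : realType)
    (P : R -> probability (pathspace R) R) (p : R -> R -> R -> R)
    (L : R -> pathspace R -> R)
    (nu : {measure set R -> \bar R}) : Prop := {
  levy_supp : nu `]-oo, 0]%classic = 0%E ;
  levy_int : (\int[nu]_(v in `]0%R, +oo[) (Num.min 1%R v)%:E < +oo)%E ;
  levy_resolvent : forall l lam : R, 0 <= l -> 0 < lam ->
    inverse_local_time_laplace P L l lam =
    (expR (- (l / resolvent p lam 0 0)))%:E ;
  levy_khintchine : forall l lam : R, 0 <= l -> 0 < lam ->
    inverse_local_time_laplace P L l lam =
    (expR (- (l * \int[nu]_(v in `]0, +oo[) (1 - expR (- (lam * v))))))%:E }.

(* (F * F)(x), where dF is the law with distribution function F. *)
Definition self_convolution (R : realType) (F : R -> R)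
    (dF : probability R R) (x : R) : R :=
  \int[dF]_y F (x - y).

Definition subexponential (R : realType) (F : R -> R) : Prop :=
  exists dF : probability R R,
  [/\ forall x, F x = fine (dF `]-oo, x]%classic),
      F x @[x --> 0^'+] --> (0 : R),
      forall x : R, 0 < x -> F x < 1,
      F x @[x --> +oo] --> (1 : R)
    & (1 - self_convolution F dF x) / (1 - F x) @[x --> +oo] --> (2 : R)].

(* The interval ]1, x] is empty when x <= 1, so this is 0 there. *)
Definition tail_df (R : realType)
    (nu : {measure set R -> \bar R}) (x : R) : R :=
  fine (nu `]1, x]%classic) / fine (nu `]1, +oo[%classic).

(* Main.v *)
Require Import Defs.
From HB Require Import structures.
From mathcomp Require Import all_boot all_order all_algebra.
From mathcomp Require Import all_classical all_reals all_analysis.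
From mathcomp Require Import measurable_realfun.
From mathcomp Require Import ring lra.
Import Order.TTheory GRing.Theory Num.Theory.
Import numFieldNormedType.Exports.
Local Open Scope classical_set_scope.
Local Open Scope ring_scope.

(* The event {L_t <= l} is {tau_l >= t}, where tau_l is the inverse local time,
   whose law has Laplace transform exp (- l * \int (1 - e^(- lam v)) nu(dv)).
   Cutting nu at 1/(k+1), this is the limit of the Laplace transforms of laws
   mu_k * rho, where rho is the compound Poisson law of the jumps larger than 1
   and mu_k, the law of the jumps in ]1/(k+1), 1], has an exponential moment of
   order 2 bounded in k.  Convergence of Laplace transforms is turned into an
   asymptotic comparison of tails through the functions
   (1 - e^(- n lam x))^(2^n), polynomials in e^(- lam x) which approach the
   indicator of x > ln 2 / lam.  Finally rho(]t, +oo[) ~ l nu(]t, +oo[) because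
   the tails G_n of the convolution powers of a subexponential law with tail H
   satisfy G_n <= B^n H and limsup G_n / H <= n, and convolving with mu_k does not
   change the asymptotics because H(t - x) <= C e^x H(t). *)

(** The cut of nu is forced by its possibly infinite mass near 0: tau_l need not be compound
    Poisson, so the expansion over the number of jumps is available only for the jumps larger than
    1. The limit in k is taken at fixed t, before the limit in t, hence every bound on the tail of
    mu_k * rho has to be uniform in k. From below this costs nothing, since mu_k lives on the
    half-line. From above, a small-jump sum x contributes at most a constant times e^x H(t); an
    exponential moment of order 2 rather than 1 leaves a spare factor e^(-x), which makes the
    contribution of x > A as small as e^(-A), whatever k is. The comparison of tails loses a gap
    between the two points at which they are taken. A gap of 1 is enough and is free in the end,
    because H(t - 1) ~ H(t); atoms thus never matter. Working with e^(- lam tau_l) also admits the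
    value +oo of tau_l, where this variable is 0. *)

Definition add2 {R : realType} (z : R * R) : R := z.1 + z.2.

Lemma measurable_add2 (R : realType) : measurable_fun [set: R * R] (@add2 R).
Proof. by apply: measurable_funD; [exact: measurable_fst|exact: measurable_snd]. Qed.

HB.instance Definition _ (R : realType) :=
  isMeasurableFun.Build _ _ _ _ (@add2 R) (measurable_add2 R).

(** * Convolutions, compound Poisson laws and their exponential integrals *)

Section convolutions.
Context {R : realType}.
Implicit Types M N F : probability R R.

Definition convolution M N : probability R R := distribution (M \x N)%E (@add2 R).

Lemma ge0_integral_convolution M N (f : R -> \bar R) :
  measurable_fun setT f -> (forall x, 0 <= f x)%E ->
  (\int[convolution M N]_x f x = \int[M]_x \int[N]_y f (x + y)%R)%E.
Proof.
move=> mf f0.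
rewrite /convolution ge0_integral_distribution//.
rewrite (@fubini_tonelli1 _ _ _ _ _ M N (f \o @add2 R))//.
  exact: measurableT_comp (measurable_add2 R).
by move=> z; exact: f0.
Qed.

Lemma convolution_tail M N (t : R) :
  (convolution M N `]t, +oo[%classic = \int[M]_x N `](t - x)%R, +oo[%classic)%E.
Proof.
rewrite /convolution /distribution /pushforward/= /product_measure1/=.
apply: eq_integral => x _; congr (N _).
apply/seteqP; split => y; rewrite /xsection/= inE/= /add2/= !in_itv/= !andbT.
  by rewrite ltrBlDl.
by rewrite ltrBlDl.
Qed.

Fixpoint convolution_pow F n : probability R R :=
  if n is n'.+1 then convolution F (convolution_pow F n') else @dirac _ R 0 R.

Definition poisson_weight (a : {nonneg R}) n : R := expR (- a%:num) * exp_coeff a%:num n.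

Lemma poisson_weight_ge0 a n : 0 <= poisson_weight a n.
Proof. by rewrite mulr_ge0 ?expR_ge0 ?exp_coeff_ge0. Qed.

Lemma exp_coeff_nneseries (x : R) : 0 <= x ->
  (\sum_(n <oo) (exp_coeff x n)%:E = (expR x)%:E)%E.
Proof.
move=> x0; rewrite -EFin_lim; last exact: is_cvg_series_exp_coeff.
by apply/congr_lim/funext => n/=; rewrite /series/= -sumEFin.
Qed.

(** The generating function of the Poisson law. It serves with x equal to 1 (total mass), to an
    exponential integral of the jump law, to the growth constant [B] of the convolution powers, and
    to [1 - H t]. *)
Lemma poisson_weight_exp a (x : R) : 0 <= x ->
  (\sum_(n <oo) (poisson_weight a n * x ^+ n)%:E =
   (expR (a%:num * (x - 1)))%:E)%E.
Proof.
move=> x0; under eq_eseriesr => n _.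
  rewrite /poisson_weight -mulrA /exp_coeff/= mulrAC -exprMn EFinM.
  over.
rewrite nneseriesZl ?exp_coeff_nneseries ?mulr_ge0//; last first.
  by move=> n _; rewrite lee_fin exp_coeff_ge0// mulr_ge0.
by rewrite -EFinM -expRD mulrBr mulr1 addrC.
Qed.

Section compound_poisson.
Variables (a : {nonneg R}) (F : probability R R).

Definition compound_poisson : set R -> \bar R := mseries (fun n =>
  mscale (NngNum (poisson_weight_ge0 a n)) (convolution_pow F n)) 0.

HB.instance Definition _ := Measure.on compound_poisson.

Lemma compound_poissonE (A : set R) :
  (compound_poisson A = \sum_(n <oo) (poisson_weight a n)%:E * convolution_pow F n A)%E.
Proof. by []. Qed.

Lemma compound_poisson_setT : compound_poisson setT = 1%E.
Proof.
rewrite compound_poissonE; under eq_eseriesr => n _.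
  rewrite probability_setT -[X in (_%:E * X%:E)%E](expr1n _ n) -EFinM; over.
by rewrite poisson_weight_exp// subrr mulr0 expR0.
Qed.

HB.instance Definition _ :=
  Measure_isProbability.Build _ _ _ compound_poisson compound_poisson_setT.

End compound_poisson.

Lemma ge0_integral_compound_poisson a F (f : R -> \bar R) :
  measurable_fun setT f -> (forall x, 0 <= f x)%E ->
  (\int[compound_poisson a F]_x f x =
   \sum_(n <oo) (poisson_weight a n)%:E * \int[convolution_pow F n]_x f x)%E.
Proof.
move=> mf f0; rewrite ge0_integral_measure_series//.
by apply: eq_eseriesr => n _; rewrite ge0_integral_mscale.
Qed.

Lemma measurable_expR_scale (s : R) : measurable_fun [set: R] (fun x => (expR (s * x))%:E).
Proof.
by apply/measurable_EFinP; apply: measurableT_comp.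
Qed.

(** One object for two uses: the Laplace transform at lam is [s = - lam], the exponential moment
    that controls the small jumps is [s = 2]. It is extended-valued because it can be infinite for a
    general law. *)
Definition exp_integral F (s : R) : \bar R := (\int[F]_x (expR (s * x)%R)%:E)%E.

Lemma exp_integral_ge0 F s : (0 <= exp_integral F s)%E.
Proof. by apply: integral_ge0 => x _; rewrite lee_fin expR_ge0. Qed.

Lemma exp_integral_convolution M N s :
  exp_integral (convolution M N) s = (exp_integral M s * exp_integral N s)%E.
Proof.
rewrite /exp_integral ge0_integral_convolution; last 2 first.
  exact: measurable_expR_scale.
  by move=> x; rewrite lee_fin expR_ge0.
under eq_integral => x _.
  under eq_integral => y _ do rewrite mulrDr expRD EFinM.
  rewrite ge0_integralZl_EFin ?expR_ge0//; last first.
    exact: measurable_expR_scale.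
  over.
rewrite ge0_integralZr//; first exact: measurable_expR_scale.
by apply: integral_ge0 => x _; rewrite lee_fin expR_ge0.
Qed.

Lemma exp_integral_convolution_pow F s n :
  exp_integral (convolution_pow F n) s = (exp_integral F s ^+ n)%E.
Proof.
elim: n => [|n IH].
  rewrite /exp_integral integral_dirac ?diracT ?mul1e ?mulr0 ?expR0//.
  exact: measurable_expR_scale.
by rewrite expeS -IH exp_integral_convolution.
Qed.

Lemma exp_integral_compound_poisson a F s : exp_integral F s \is a fin_num ->
  exp_integral (compound_poisson a F) s = (expR (a%:num * (fine (exp_integral F s) - 1)))%:E.
Proof.
move=> fF; rewrite /exp_integral ge0_integral_compound_poisson; last 2 first.
  exact: measurable_expR_scale.
  by move=> x; rewrite lee_fin expR_ge0.
have x0 : 0 <= fine (exp_integral F s) by rewrite fine_ge0 ?exp_integral_ge0.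
rewrite -(poisson_weight_exp a (fine (exp_integral F s)) x0).
apply: eq_eseriesr => n _.
rewrite -/(exp_integral _ _) exp_integral_convolution_pow.
by rewrite -{1}(fineK fF) -EFin_expe -EFinM.
Qed.

End convolutions.

(** * Tails of probability laws on the line *)

Section tails.
Context {R : realType}.
Implicit Types M N F : probability R R.

Lemma integrable_bounded d (T : measurableType d) (P : probability T R) (f : T -> R) (C : R) :
  measurable_fun setT f -> (forall x, `|f x| <= C) ->
  P.-integrable setT (EFin \o f).
Proof.
move=> mf fC; apply: measurable_bounded_integrable => //.
  exact: fin_num_fun_lty.
exists C; split; first exact: num_real.
by move=> y Cy x _; exact: le_trans (fC x) (ltW Cy).
Qed.

Lemma Rintegral_probability_cst d (T : measurableType d) (P : probability T R) (c : R) :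
  \int[P]_(x in setT) c = c.
Proof.
rewrite Rintegral_cst//; transitivity (c * fine (1 : \bar R)); last by rewrite mulr1.
by congr (_ * fine _); exact: probability_setT.
Qed.

Definition tail M (t : R) : R := fine (M `]t, +oo[%classic).

Lemma tailE M t : ((tail M t)%:E = M `]t, +oo[%classic)%E.
Proof. by rewrite fineK// fin_num_measure. Qed.

Lemma tail_ge0 M t : 0 <= tail M t.
Proof. exact: fine_ge0. Qed.

Lemma tail_le1 M t : tail M t <= 1.
Proof. by rewrite -lee_fin tailE probability_le1. Qed.

Lemma tail_nonincreasing M (s t : R) : s <= t -> tail M t <= tail M s.
Proof.
move=> st; rewrite -lee_fin !tailE le_measure ?inE//.
by apply: subset_itvr; rewrite bnd_simp.
Qed.

Lemma measurable_tail M : measurable_fun setT (tail M).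
Proof.
apply: nonincreasing_measurable => // x y xy.
exact: tail_nonincreasing.
Qed.

Lemma tail_cdf M t : fine (M `]-oo, t]%classic) = 1 - tail M t.
Proof.
apply: EFin_inj; rewrite EFinB tailE fineK ?fin_num_measure//.
rewrite -setCitvr probability_setC//.
Qed.

Lemma tail_eq1 M t : M `]-oo, t]%classic = 0%E -> tail M t = 1.
Proof. by move=> M0; have := tail_cdf M t; rewrite M0/= => /esym/subr0_eq. Qed.

Lemma tail_neg_eq1 M t : M `]-oo, 0[%classic = 0%E -> t < 0 -> tail M t = 1.
Proof.
move=> M0 t0; apply: tail_eq1; apply/eqP; rewrite eq_le measure_ge0 andbT -M0.
apply: le_measure; rewrite ?inE//.
by apply: subset_itvl; rewrite bnd_simp.
Qed.

Lemma integrable_tail_shift M N (t : R) :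
  M.-integrable setT (EFin \o (fun x => tail N (t - x))).
Proof.
apply: (@integrable_bounded _ _ _ _ 1).
  apply: measurableT_comp; first exact: measurable_tail.
  exact: measurable_funB.
by move=> x; rewrite ger0_norm ?tail_ge0 ?tail_le1.
Qed.

Lemma tail_convolution M N t : tail (convolution M N) t = \int[M]_x tail N (t - x).
Proof.
rewrite /tail convolution_tail /Rintegral; congr fine.
by apply: eq_integral => x _; rewrite tailE.
Qed.

(** Integrands such as [tail N (t - x)] are bounded by step functions of x; written with these
    indicators, their integrals are combinations of tails. *)
Definition ray_indic (s x : R) : R := \1_(`]s, +oo[ : set R) x.

Lemma ray_indicE (s x : R) : ray_indic s x = (s < x)%R%:R.
Proof. by rewrite /ray_indic indicE mem_setE in_itv/= andbT. Qed.

Lemma integrable_ray_indicZ M (c s : R) : M.-integrable setT (EFin \o (fun x => c * ray_indic s x)).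
Proof.
apply: (@integrable_bounded _ _ _ _ `|c|).
  by apply: measurable_funM => //; exact: measurable_indic.
move=> x; rewrite normrM ler_piMr// ray_indicE.
by case: (s < x); rewrite ?normr1// normr0.
Qed.

Lemma Rintegral_ray_indicZ M (c s : R) : \int[M]_x (c * ray_indic s x) = c * tail M s.
Proof.
have iray : M.-integrable setT (EFin \o ray_indic s).
  by have := integrable_ray_indicZ M 1 s; under eq_fun do rewrite /= mul1r.
rewrite RintegralZl//; congr (_ * _).
by rewrite /Rintegral /ray_indic integral_indic// setIT.
Qed.


Lemma convolution_neg0 M N : M `]-oo, 0[%classic = 0%E -> N `]-oo, 0[%classic = 0%E ->
  convolution M N `]-oo, 0[%classic = 0%E.
Proof.
move=> M0 N0; apply/eqP; rewrite eq_le measure_ge0 andbT.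
rewrite /convolution /distribution /pushforward.
have mA : measurable (`]-oo, 0[ : set R) by [].
have m1 : measurable ((`]-oo, 0[ : set R) `*` [set: R]) by exact: measurableX.
have m2 : measurable ([set: R] `*` (`]-oo, 0[ : set R)) by exact: measurableX.
apply: (@le_trans _ _ ((M \x N)%E (((`]-oo, 0[ : set R) `*` [set: R]) `|`
    ([set: R] `*` (`]-oo, 0[ : set R))))).
  apply: (@le_measure _ _ _ (M \x N)%E); rewrite ?inE//.
  - by rewrite -[X in measurable X]setTI; exact: measurable_add2.
  - exact: measurableU.
  - move=> [x y]; rewrite /add2/= !in_itv/= => xy0.
    have [x0|x0] := ltP x 0; [by left|right; split => //=].
    by move: xy0; rewrite /add2/=; lra.
apply: (le_trans (@measureU2 _ _ _ (M \x N)%E _ _ m1 m2)).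
have e1 : (M \x N)%E ((`]-oo, 0[ : set R) `*` [set: R]) = 0%E.
  by rewrite product_measure1E// [X in (X * _)%E]M0 mul0e.
have e2 : (M \x N)%E ([set: R] `*` (`]-oo, 0[ : set R)) = 0%E.
  by rewrite product_measure1E// [X in (_ * X)%E]N0 mule0.
rewrite -[leRHS]adde0; apply: leeD; [by rewrite -[leRHS]e1|by rewrite -[leRHS]e2].
Qed.

Lemma convolution_pow_neg0 F n : F `]-oo, 0[%classic = 0%E ->
  convolution_pow F n `]-oo, 0[%classic = 0%E.
Proof.
move=> F0; elim: n => [|n IH]; last exact: convolution_neg0.
by rewrite /= diracE memNset//= in_itv/= ltxx.
Qed.

Lemma compound_poisson_neg0 a F : F `]-oo, 0[%classic = 0%E ->
  compound_poisson a F `]-oo, 0[%classic = 0%E.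
Proof.
move=> F0; rewrite compound_poissonE eseries0// => n _ _.
by rewrite convolution_pow_neg0 ?mule0.
Qed.

(** A nonnegative summand can only increase a sum. This will compare the law of all the jumps with
    that of the large ones, uniformly in the cut. *)
Lemma tail_convolution_ge M N t : M `]-oo, 0[%classic = 0%E ->
  tail N t <= tail (convolution M N) t.
Proof.
move=> M0; rewrite -lee_fin !tailE convolution_tail -tailE.
have mS : measurable (~` `]-oo, 0[ : set R) by exact: measurableC.
have mf : measurable_fun [set: R] (fun x : R => N `](t - x)%R, +oo[%classic).
  under eq_fun do rewrite -tailE; apply/measurable_EFinP.
  apply: measurableT_comp; first exact: measurable_tail.
  exact: measurable_funB.
have {1}-> : (tail N t)%:E =
    (\int[M]_(x in (~` `]-oo, 0%R[)%classic) (cst (tail N t)%:E x))%E.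
  rewrite integral_cst// -[LHS]mule1; congr (_ * _)%E.
  transitivity (1 - M `]-oo, 0%R[%classic)%E; first by rewrite M0 sube0.
  by rewrite -probability_setC.
apply: (@le_trans _ _ (\int[M]_(x in (~` `]-oo, 0%R[)%classic) N `](t - x)%R, +oo[%classic))%E.
  apply: ge0_le_integral => //.
  - by move=> x _; rewrite lee_fin tail_ge0.
  - exact: measurable_funTS.
  - move=> x/=; rewrite in_itv/= => /negP; rewrite -leNgt => x0.
    by rewrite -tailE lee_fin tail_nonincreasing// gerBl.
by apply: ge0_subset_integral => //.
Qed.

End tails.

(** * Convolution powers of a subexponential law *)

Section subexponential_tail.
Context {R : realType} (F : probability R R).
Hypothesis F_le0 : F `]-oo, 0]%classic = 0%E.
Hypothesis tail_gt0 : forall t, 0 < tail F t.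
Hypothesis tail_cvg0 : tail F t @[t --> +oo] --> (0 : R).
Hypothesis tail_square_le : forall e : R, 0 < e ->
  \forall t \near +oo, tail (convolution F F) t <= (2 + e) * tail F t.

Local Notation H := (tail F).
Local Notation G n := (tail (convolution_pow F n)).

Lemma support_ge0 : F `]-oo, 0[%classic = 0%E.
Proof.
apply/eqP; rewrite eq_le measure_ge0 andbT -F_le0.
by apply: le_measure; rewrite ?inE//; apply: subset_itvl; rewrite bnd_simp.
Qed.

Lemma near_tail_le (e : R) : 0 < e -> \forall t \near +oo, H t <= e.
Proof.
move=> e0; move/cvgrPdist_le : tail_cvg0 => /(_ e e0); apply: filterS => t.
by rewrite sub0r normrN ger0_norm ?tail_ge0.
Qed.

(* Condition on the first summand v and bound H (t - v) below by 1, H (t - s) or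
   H t according to whether v > t, s < v <= t or 0 < v <= s. *)
Lemma tail_convolution_square_ge (s t : R) : 0 <= s -> s <= t ->
  H t * (2 - H s) + H (t - s) * (H s - H t) <= tail (convolution F F) t.
Proof.
move=> s0 st; rewrite tail_convolution.
pose g x := (H t * ray_indic 0 x + (H (t - s) - H t) * ray_indic s x) +
  (1 - H (t - s)) * ray_indic t x.
have ig1 : F.-integrable setT
    (EFin \o (fun x => H t * ray_indic 0 x + (H (t - s) - H t) * ray_indic s x)).
  rewrite (_ : EFin \o _ = ((EFin \o (fun x : R => (H t * ray_indic 0 x)%R)) \+
     (EFin \o (fun x : R => ((H (t - s) - H t) * ray_indic s x)%R)))%E) //.
  by apply: integrableD => //; exact: integrable_ray_indicZ.
have ig : F.-integrable setT (EFin \o g).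
  rewrite (_ : EFin \o _ = ((EFin \o
     (fun x => H t * ray_indic 0 x + (H (t - s) - H t) * ray_indic s x)%R) \+
     (EFin \o (fun x : R => ((1 - H (t - s)) * ray_indic t x)%R)))%E) //.
  by apply: integrableD => //; exact: integrable_ray_indicZ.
have -> : H t * (2 - H s) + H (t - s) * (H s - H t) = \int[F]_x g x.
  rewrite RintegralD//; last exact: integrable_ray_indicZ.
  rewrite RintegralD//; try exact: integrable_ray_indicZ.
  rewrite !Rintegral_ray_indicZ (@tail_eq1 _ F 0)//; ring.
apply: le_Rintegral => //; first exact: integrable_tail_shift.
move=> x _; rewrite /g !ray_indicE.
have h1 := tail_le1 F (t - s).
have [x0|x0] := ltP 0 x; have [sx|xs] := ltP s x; have [tx|xt] := ltP t x;
  rewrite /= ?mulr1 ?mulr0 ?addr0 ?add0r; try (exfalso; lra).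
- rewrite (@tail_neg_eq1 _ _ (t - x)) ?support_ge0 ?subr_lt0//; lra.
- have : H (t - s) <= H (t - x) by rewrite tail_nonincreasing//; lra.
  lra.
- by rewrite tail_nonincreasing// gerBl ltW.
- exact: tail_ge0.
Qed.

(** The lower bound above and [tail_square_le] enclose the tail of the twofold convolution and leave
    [H (t - s) * (H s - H t) <= H t * (h + H s)]. Dividing by [H s - H t], which tends to [H s > 0],
    gives a factor close to 1. *)
Lemma long_tailed (s e : R) : 0 <= s -> 0 < e ->
  \forall t \near +oo, H (t - s) <= (1 + e) * H t.
Proof.
move=> s0 e0.
have Hs := tail_gt0 s.
(* The division needs [h + (1 + e) * H t <= e * H s]; each of the two terms receives half of the
   right-hand side. *)
pose h := e * H s / 2.
have h0 : 0 < h by rewrite divr_gt0// mulr_gt0.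
have k0 : 0 < h / (1 + e) by rewrite divr_gt0//; lra.
near=> t.
have st : s <= t by near: t; apply: nbhs_pinfty_ge; exact: num_real.
have G2 : tail (convolution F F) t <= (2 + h) * H t by near: t; exact: tail_square_le.
have Ht : H t <= h / (1 + e) by near: t; exact: near_tail_le.
have Ht' : (1 + e) * H t <= h by rewrite mulrC -ler_pdivlMr//; lra.
have HtHs : H t < H s.
  have : e * H t >= 0 by rewrite mulr_ge0 ?tail_ge0// ltW.
  move: Ht'; rewrite /h mulrDl mul1r.
  (have := tail_gt0 t); nra.
have := tail_convolution_square_ge s t s0 st.
have Hp := tail_gt0 t.
have H0 := tail_ge0 F (t - s).
move=> Hge.
rewrite -(@ler_pM2r _ (H s - H t)); last by rewrite subr_gt0.
have : H (t - s) * (H s - H t) <= H t * (h + H s) by nra.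
move/le_trans; apply.
rewrite -mulrA mulrCA ler_pM2l//.
rewrite /h in Ht' *; nra.
Unshelve. all: by end_near. Qed.

(* Condition on the first summand v: if v > t both tails equal 1, and if
   t - T < v <= t the tail of the n-fold convolution is merely at most 1. *)
Lemma tail_convolution_pow_step (n : nat) (c T t : R) : 0 <= c -> 0 <= T ->
  (forall s, T <= s -> G n s <= c * H s) ->
  G n.+1 t + c * H t <= c * tail (convolution F F) t + H (t - T).
Proof.
move=> c0 T0 GT; rewrite !tail_convolution -/convolution_pow.
have iH : F.-integrable setT (EFin \o (fun x => c * H (t - x))).
  have := integrable_tail_shift F F t.
  by move/(integrableZl measurableT c); exact.
rewrite -RintegralZl//; last exact: integrable_tail_shift.
rewrite -(Rintegral_ray_indicZ F c t) -[H (t - T)]mul1r -(Rintegral_ray_indicZ F 1 (t - T)).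
rewrite -!RintegralD//; try exact: integrable_ray_indicZ; try exact: integrable_tail_shift.
apply: le_Rintegral => //.
- rewrite (_ : EFin \o _ = ((EFin \o (fun x : R => G n (t - x))) \+
     (EFin \o (fun x : R => (c * ray_indic t x)%R)))%E) //.
  by apply: integrableD => //; [exact: integrable_tail_shift|exact: integrable_ray_indicZ].
- rewrite (_ : EFin \o _ = ((EFin \o (fun x : R => (c * H (t - x))%R)) \+
     (EFin \o (fun x : R => (1 * ray_indic (t - T) x)%R)))%E) //.
  by apply: integrableD => //; exact: integrable_ray_indicZ.
move=> x _; rewrite !ray_indicE.
have G1 := tail_le1 (convolution_pow F n) (t - x).
have cH : 0 <= c * H (t - x) by rewrite mulr_ge0 ?tail_ge0.
have [tx|xt] := ltP t x.
  rewrite (_ : t - T < x) ?mulr1; last by lra.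
  rewrite (@tail_neg_eq1 _ F (t - x)) ?support_ge0 ?subr_lt0//=; lra.
rewrite mulr0 addr0.
have [tx|xT] := ltP (t - T) x; first by rewrite mulr1; lra.
by rewrite mulr0 addr0 GT//; lra.
Qed.

Lemma tail_convolution_pow0 (t : R) : 0 <= t -> G 0 t = 0.
Proof.
move=> t0; apply: EFin_inj; rewrite tailE /= diracE memNset//= in_itv/= andbT.
by apply/negP; rewrite -leNgt.
Qed.

(** Induction on n. In the step inequality the tail of the twofold convolution is about [2 * H t],
    so that one [c * H t] cancels and c, close to n, survives; [H (t - T)] is about [H t] and
    supplies the extra unit. *)
Lemma tail_convolution_pow_near (n : nat) (e : R) : 0 < e ->
  \forall t \near +oo, G n t <= (n%:R + e) * H t.
Proof.
elim: n e => [|n IH] e e0.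
  near=> t; rewrite add0r tail_convolution_pow0; first by rewrite mulr_ge0 ?tail_ge0// ltW.
  by near: t; apply: nbhs_pinfty_ge; exact: num_real.
have e20 : 0 < e / 2 by rewrite divr_gt0.
have [T [_ HT]] := IH _ e20.
(* The induction hypothesis holds for s > T only, while the step inequality wants a nonnegative
   threshold that is itself included. *)
pose T' := Num.max T 0 + 1.
have TT' : T < T' by rewrite /T'; case: (leP T 0); lra.
have T'0 : 0 <= T' by rewrite /T'; case: (leP T 0); lra.
pose c := n%:R + e / 2.
have c0 : 0 <= c by rewrite addr_ge0// ltW.
(* The step yields the factor (c + 1)(1 + h), and h (c + 1) = e / 2 makes it n + 1 + e. *)
pose h := e / 2 / (c + 1).
have h0 : 0 < h by rewrite divr_gt0//; lra.
near=> t.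
have step : G n.+1 t + c * H t <= c * tail (convolution F F) t + H (t - T').
  by apply: tail_convolution_pow_step => // s sT; apply: HT; lra.
have G2 : tail (convolution F F) t <= (2 + h) * H t by near: t; exact: tail_square_le.
have HL : H (t - T') <= (1 + h) * H t by near: t; exact: long_tailed.
have hc : h * (c + 1) = e / 2 by rewrite divfK//; apply/eqP; lra.
have -> : n.+1%:R + e = c + 1 + h * (c + 1) by rewrite hc /c -natr1; lra.
have : c * tail (convolution F F) t <= c * ((2 + h) * H t) by rewrite ler_wpM2l.
nra.
Unshelve. all: by end_near. Qed.

(** Beyond the threshold the hypothesis with e = 1 gives the factor 3; before it the left side is at
    most 1, while [H t] stays above the positive number [H (T + 1)]. *)
Lemma tail_square_bound : exists2 B, 0 <= B & forall t, tail (convolution F F) t <= B * H t.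
Proof.
have [T [_ HT]] := tail_square_le 1 ltr01.
pose k := (H (T + 1))^-1.
have k0 : 0 <= k by rewrite invr_ge0 tail_ge0.
exists (3 + k); first by rewrite addr_ge0.
move=> t; have Ht := tail_ge0 F t.
have [Tt|tT] := ltP T t.
  have : 0 <= k * H t by rewrite mulr_ge0.
  by have := HT _ Tt; rewrite mulrDl; lra.
apply: (le_trans (tail_le1 _ _)).
have : 1 <= k * H t.
  by rewrite mulrC ler_pdivlMr// mul1r tail_nonincreasing//; lra.
rewrite mulrDl; lra.
Qed.

(** A crude form of Kesten's bound: any geometric growth is summable against Poisson weights. It
    must hold for every t, negative ones included, because the induction integrates it at all points
    t - x and then falls back on the twofold convolution. *)
Lemma tail_convolution_pow_bound : exists2 B, 0 <= B & forall n t, G n t <= B ^+ n * H t.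
Proof.
have [B B0 HB] := tail_square_bound; exists B => //; elim => [|n IH] t.
  rewrite expr0 mul1r; have [t0|t0] := ltP t 0.
    by rewrite (@tail_neg_eq1 _ F t) ?support_ge0// tail_le1.
  by rewrite tail_convolution_pow0// tail_ge0.
have Bn : 0 <= B ^+ n by rewrite exprn_ge0.
rewrite /= tail_convolution exprSr -mulrA.
apply: (@le_trans _ _ (\int[F]_x (B ^+ n * H (t - x)))).
  apply: le_Rintegral => //; first exact: integrable_tail_shift.
  have := integrable_tail_shift F F t.
  by move/(integrableZl measurableT (B ^+ n)); exact.
rewrite RintegralZl//; last exact: integrable_tail_shift.
by rewrite -tail_convolution ler_wpM2l.
Qed.

(** A sum of nonnegative jumps exceeds t as soon as one of them does; the left side is the
    probability that the largest of n jumps exceeds t. *)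
Lemma tail_convolution_pow_ge (n : nat) (t : R) : 0 <= t -> 1 - (1 - H t) ^+ n <= G n t.
Proof.
move=> t0; elim: n => [|n IH].
  by rewrite expr0 subrr tail_ge0.
have H1 := tail_le1 F t; have G1 := tail_le1 (convolution_pow F n) t.
apply: (@le_trans _ _ (G n t * (1 - H t) + H t)).
  by rewrite exprSr; nra.
rewrite /= tail_convolution.
pose g x := G n t * ray_indic 0 x + (1 - G n t) * ray_indic t x.
have ig : F.-integrable setT (EFin \o g).
  rewrite (_ : EFin \o _ = ((EFin \o (fun x : R => (G n t * ray_indic 0 x)%R)) \+
     (EFin \o (fun x : R => ((1 - G n t) * ray_indic t x)%R)))%E) //.
  by apply: integrableD => //; exact: integrable_ray_indicZ.
have -> : G n t * (1 - H t) + H t = \int[F]_x g x.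
  rewrite RintegralD//; try exact: integrable_ray_indicZ.
  by rewrite !Rintegral_ray_indicZ (@tail_eq1 _ F 0)//; ring.
apply: le_Rintegral => //; first exact: integrable_tail_shift.
move=> x _; rewrite /g !ray_indicE.
have G0 := tail_ge0 (convolution_pow F n) (t - x).
have [x0|x0] := ltP 0 x; have [tx|xt] := ltP t x;
  rewrite /= ?mulr1 ?mulr0 ?addr0 ?add0r//; try (exfalso; lra).
- rewrite (@tail_neg_eq1 _ _ (t - x)) ?subr_lt0//; last exact/convolution_pow_neg0/support_ge0.
  by lra.
- by rewrite tail_nonincreasing// gerBl ltW.
Qed.

(** Long-tailedness with unit shift gives [H (t - 1) <= expR 1 * H t] beyond some T, and this is
    iterated. Once the point has come down to T + 1 or below, [1 <= C * H t] finishes, so C is paid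
    only once. *)
Lemma tail_exp_bound : exists2 C, 0 <= C &
  forall t x, 0 <= x -> H (t - x) <= C * expR x * H t.
Proof.
have e10 : 0 < expR 1 - 1 :> R by rewrite subr_gt0 expR_gt1.
have [T [_ HT]] := long_tailed 1 _ ler01 e10.
pose C := (H (T + 1))^-1.
have C0 : 0 <= C by rewrite invr_ge0 tail_ge0.
have base n t s : t <= T + 1 -> H s <= C * expR n%:R * H t.
  move=> tT; apply: (le_trans (tail_le1 _ _)).
  have h1 : 1 <= C * H t.
    by rewrite mulrC ler_pdivlMr// mul1r tail_nonincreasing.
  by rewrite mulrAC -[leLHS]mulr1 ler_pM// -expR0 ler_expR.
have Hn n t : H (t - n%:R) <= C * expR n%:R * H t.
  elim: n t => [|n IH] t; have [tT|Tt] := leP t (T + 1); try exact: base.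
    rewrite expR0 mulr1 subr0 ler_peMl ?tail_ge0//.
    by rewrite invf_ge1 ?tail_le1.
  have -> : t - n.+1%:R = (t - 1) - n%:R by rewrite -natr1; ring.
  apply: (le_trans (IH (t - 1))).
  rewrite -natr1 expRD -!mulrA; apply: ler_wpM2l => //; apply: ler_wpM2l; first exact: expR_ge0.
  by have := HT t; rewrite (_ : 1 + (expR 1 - 1) = expR 1); [apply|]; lra.
(* The extra factor e pays for rounding x up to an integer. *)
exists (C * expR 1); first by rewrite mulr_ge0 ?expR_ge0.
move=> t x x0.
have := truncn_itv x0; set n := Num.truncn x => /andP[nx xn].
apply: (@le_trans _ _ (H (t - n.+1%:R))).
  by rewrite tail_nonincreasing// lerD2l lerN2 ltW.
apply: (le_trans (Hn _ _)); rewrite ler_wpM2r ?tail_ge0//.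
rewrite -mulrA ler_wpM2l// -expRD ler_expR -natr1; lra.
Qed.

End subexponential_tail.

(** * The tail of a compound Poisson law with subexponential jumps *)

Section compound_poisson_tail.
Context {R : realType} (F : probability R R) (a : {nonneg R}).

Local Notation H := (tail F).
Local Notation G n := (tail (convolution_pow F n)).
Local Notation w := (poisson_weight a).
Local Notation rho := (tail (compound_poisson a F)).

Lemma tail_compound_poissonE t : ((rho t)%:E = \sum_(n <oo) (w n * G n t)%:E)%E.
Proof.
rewrite tailE [LHS]compound_poissonE; apply: eq_eseriesr => n _.
by rewrite [RHS]EFinM tailE.
Qed.

Lemma poisson_weight_sum1 : (\sum_(n <oo) (w n)%:E = 1 :> \bar R)%E.
Proof.
have := poisson_weight_exp a 1 ler01; rewrite subrr mulr0 expR0 => <-.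
by apply: eq_eseriesr => n _; rewrite expr1n mulr1.
Qed.

(** Since (n + 1) w(n + 1) = a w(n), the sum is a times a partial sum of the weights, which is at
    most 1. *)
Lemma poisson_weight_mean N : \sum_(0 <= n < N) w n * n%:R <= a%:num.
Proof.
have E : \sum_(0 <= n < N.+1) w n * n%:R = a%:num * \sum_(0 <= n < N) w n.
  rewrite big_nat_recl// mulr0 add0r mulr_sumr; apply: eq_big_nat => n _.
  rewrite /poisson_weight /exp_coeff/= factS natrM exprS invfM.
  have : n.+1%:R != 0 :> R by rewrite pnatr_eq0.
  have : n`!%:R != 0 :> R by rewrite pnatr_eq0 -lt0n fact_gt0.
  move: (n.+1%:R : R) (n`!%:R : R) => k f f0 k0.
  by field; rewrite k0 f0.
apply: (@le_trans _ _ (\sum_(0 <= n < N.+1) w n * n%:R)).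
  by rewrite big_nat_recr//= lerDl mulr_ge0 ?poisson_weight_ge0.
rewrite E ler_piMr//.
rewrite -lee_fin -poisson_weight_sum1 -sumEFin.
by apply: nneseries_lim_ge => n _; rewrite lee_fin poisson_weight_ge0.
Qed.

Hypothesis F_le0 : F `]-oo, 0]%classic = 0%E.
Hypothesis tail_gt0 : forall t, 0 < tail F t.
Hypothesis tail_cvg0 : tail F t @[t --> +oo] --> (0 : R).
Hypothesis tail_square_le : forall e : R, 0 < e ->
  \forall t \near +oo, tail (convolution F F) t <= (2 + e) * tail F t.

Lemma tail_compound_poisson_bound : exists2 D, 0 <= D & forall t, rho t <= D * H t.
Proof.
have [B B0 HB] := @tail_convolution_pow_bound _ F F_le0 tail_gt0 tail_square_le.
exists (expR (a%:num * (B - 1))); first exact: expR_ge0.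
move=> t; rewrite -lee_fin tail_compound_poissonE EFinM -poisson_weight_exp// muleC.
rewrite -nneseriesZl; last first.
  by move=> n _; rewrite lee_fin mulr_ge0 ?poisson_weight_ge0 ?exprn_ge0.
apply: lee_nneseries => n _; first by rewrite lee_fin mulr_ge0 ?poisson_weight_ge0 ?tail_ge0.
by rewrite -EFinM lee_fin mulrCA ler_wpM2l ?poisson_weight_ge0// mulrC HB.
Qed.

(** Dominated convergence by hand: the terms n >= N are controlled for all t by the tail of the
    series of w(n) B^n, and the finitely many others by their asymptotics. The weighted sum of the
    factors n is at most the mean a. *)
Lemma tail_compound_poisson_upper (e : R) : 0 < e ->
  \forall t \near +oo, rho t <= (a%:num + e) * H t.
Proof.
move=> e0.
have [B B0 HB] := @tail_convolution_pow_bound _ F F_le0 tail_gt0 tail_square_le.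
have e20 : 0 < e / 2 by rewrite divr_gt0.
have wB0 n : (0 <= (w n * B ^+ n)%:E)%E.
  by rewrite lee_fin mulr_ge0 ?poisson_weight_ge0 ?exprn_ge0.
have : (\sum_(N <= n <oo) (w n * B ^+ n)%:E @[N --> \oo] --> 0)%E.
  apply: (@nneseries_tail_cvg _ (fun n => (w n * B ^+ n)%:E) xpredT) => //.
  by rewrite poisson_weight_exp// ltry.
move=> /fine_cvgP[_] /cvgrPdist_le /(_ _ e20)[N _ /(_ N (leqnn N))].
rewrite /= sub0r normrN ger0_norm; last by apply: fine_ge0; exact: nneseries_ge0.
set r := (\sum_(N <= n <oo) _)%E => rN.
(* [fine] sends +oo to 0, so the bound on [fine r] has no content until r is known to be finite. *)
have rfin : r \is a fin_num.
  rewrite ge0_fin_numE; last exact: nneseries_ge0.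
  rewrite ltNge leye_eq; apply/negP => /eqP ry.
  have := nneseries_split 0 N (f := fun n => (w n * B ^+ n)%:E).
  rewrite add0n poisson_weight_exp// => /(_ (fun k _ => wB0 k)).
  by rewrite -/r ry addey// sumEFin.
have GN : \forall t \near +oo, forall n, (n < N)%N -> G n t <= (n%:R + e / 2) * H t.
  elim: N {r rN rfin} => [|N IH]; first by near=> t.
  near=> t => n; rewrite ltnS leq_eqVlt => /predU1P[->|nN].
    by near: t; exact: tail_convolution_pow_near.
  by move: n nN; near: t; exact: IH.
near=> t.
have GNt : forall n, (n < N)%N -> G n t <= (n%:R + e / 2) * H t by near: t.
rewrite -lee_fin tail_compound_poissonE (nneseries_split 0 N); last first.
  by move=> n _; rewrite lee_fin mulr_ge0 ?poisson_weight_ge0 ?tail_ge0.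
rewrite add0n.
have -> : a%:num + e = (a%:num + e / 2) + e / 2 by lra.
rewrite mulrDl EFinD; apply: leeD.
  rewrite sumEFin lee_fin.
  apply: (@le_trans _ _ ((\sum_(0 <= n < N) (w n * n%:R + e / 2 * w n)) * H t)).
    rewrite mulr_suml; apply: ler_sum_nat => n /andP[_ nN].
    rewrite [_ / _ * _]mulrC -mulrDr -mulrA ler_wpM2l ?poisson_weight_ge0//.
    exact: GNt.
  rewrite ler_wpM2r ?tail_ge0// big_split/= lerD ?poisson_weight_mean//.
  rewrite -mulr_sumr ler_piMr//; first exact: ltW.
  rewrite -lee_fin -poisson_weight_sum1 -sumEFin.
  by apply: nneseries_lim_ge => n _; rewrite lee_fin poisson_weight_ge0.
apply: (@le_trans _ _ (r * (H t)%:E)%E).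
  rewrite muleC -nneseriesZl//.
  apply: lee_nneseries => n _; first by rewrite lee_fin mulr_ge0 ?poisson_weight_ge0 ?tail_ge0.
  by rewrite -EFinM lee_fin mulrCA ler_wpM2l ?poisson_weight_ge0// mulrC HB.
rewrite EFinM lee_wpmul2r ?lee_fin ?tail_ge0//.
by rewrite -(fineK rfin) lee_fin.
Unshelve. all: by end_near. Qed.

(** The number of jumps larger than t is Poisson of mean [a * H t], so at least one occurs with
    probability 1 - exp(- a H t). With y = a H t this is at least y - y^2, and y^2 is at most
    [e * H t] once H t is small. *)
Lemma tail_compound_poisson_lower (e : R) : 0 < e ->
  \forall t \near +oo, (a%:num - e) * H t <= rho t.
Proof.
move=> e0.
(* This threshold for [H t] gives a^2 H t <= e; the added 1 keeps the denominator positive when a =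
   0. *)
have d0 : 0 < e / (a%:num ^+ 2 + 1).
  by rewrite divr_gt0// ltr_wpDl// sqr_ge0.
near=> t.
have t0 : 0 <= t by near: t; apply: nbhs_pinfty_ge; exact: num_real.
have Ht : H t * (a%:num ^+ 2 + 1) <= e.
  rewrite -ler_pdivlMr ?ltr_wpDl ?sqr_ge0//.
  by near: t; exact: near_tail_le.
have H0 := tail_gt0 t; have H1 := tail_le1 F t.
have a0 : 0 <= a%:num by [].
have aH0 : 0 <= a%:num * H t by rewrite mulr_ge0// ltW.
apply: (@le_trans _ _ (1 - expR (- (a%:num * H t)))); last first.
  rewrite lerBlDr -lee_fin EFinD tail_compound_poissonE -poisson_weight_sum1.
  have -> : - (a%:num * H t) = a%:num * ((1 - H t) - 1) by ring.
  rewrite -poisson_weight_exp ?subr_ge0// -nneseriesD; last 2 first.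
  - by move=> n _; rewrite lee_fin mulr_ge0 ?poisson_weight_ge0 ?tail_ge0.
  - by move=> n _; rewrite lee_fin mulr_ge0 ?poisson_weight_ge0 ?exprn_ge0 ?subr_ge0.
  apply: lee_nneseries => n _; first by rewrite lee_fin poisson_weight_ge0.
  rewrite -EFinD -mulrDr lee_fin ler_peMr ?poisson_weight_ge0//.
  by rewrite -lerBlDr tail_convolution_pow_ge.
have := expR_ge1Dx (a%:num * H t); set y := a%:num * H t in aH0 * => yexp.
have : expR (- y) <= (1 + y)^-1.
  by rewrite expRN lef_pV2 ?posrE ?expR_gt0//; lra.
have : (1 + y)^-1 <= 1 - y + y ^+ 2.
  rewrite -[leLHS]mul1r ler_pdivrMr; last by lra.
  have : 0 <= y ^+ 3 by rewrite exprn_ge0.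
  rewrite !exprS expr0; nra.
have : y ^+ 2 <= e * H t.
  rewrite /y exprMn.
  have : H t * (a%:num ^+ 2) <= e by have := ltW H0; nra.
  rewrite [H t ^+ 2]expr2; nra.
rewrite mulrBl -/y; lra.
Unshelve. all: by end_near. Qed.

(** The summand x drawn from M is cut at A. For x <= A, rho is monotone; for x > A, [rho (t - x)] is
    at most D C e^x H(t), and e^x <= e^(2 x - A). The constant K is chosen before M, k, A and t, so
    one bound covers all the small-jump laws. *)
Lemma tail_convolution_compound_poisson_upper : exists2 K, 0 <= K &
  forall (M : probability R R) (k A t : R), (exp_integral M 2 <= k%:E)%E -> 0 <= A ->
  tail (convolution M (compound_poisson a F)) t <= rho (t - A) + K * k * expR (- A) * H t.
Proof.
have [D D0 HD] := tail_compound_poisson_bound.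
have [C C0 HC] := @tail_exp_bound _ F F_le0 tail_gt0 tail_cvg0 tail_square_le.
exists (D * C); first by rewrite mulr_ge0.
move=> M k A t Mk A0.
pose c := D * C * expR (- A) * H t.
have c0 : 0 <= c by rewrite !mulr_ge0 ?expR_ge0 ?tail_ge0.
rewrite -lee_fin tailE convolution_tail.
apply: (@le_trans _ _ (\int[M]_x ((rho (t - A))%:E + c%:E * (expR (2 * x)%R)%:E))%E).
  apply: ge0_le_integral => //.
  - under eq_fun do rewrite -tailE; apply/measurable_EFinP.
    by apply: measurableT_comp; [exact: measurable_tail|exact: measurable_funB].
  - apply: emeasurable_funD => //; apply: measurable_funeM.
    exact: measurable_expR_scale.
  move=> x _; rewrite -tailE -EFinM -EFinD lee_fin.
  have [xA|Ax] := leP x A.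
    apply: ler_wpDr; first by rewrite mulr_ge0 ?expR_ge0.
    by rewrite tail_nonincreasing// lerD2l lerN2.
  apply: ler_wpDl; first exact: tail_ge0.
  have x0 : 0 <= x by lra.
  apply: (le_trans (HD _)).
  apply: (@le_trans _ _ (D * (C * expR x * H t))); first by rewrite ler_wpM2l ?HC.
  have -> : D * (C * expR x * H t) = D * C * H t * expR x by ring.
  have -> : c * expR (2 * x) = D * C * H t * expR (2 * x - A).
    by rewrite addrC expRD /c; ring.
  by rewrite ler_wpM2l ?mulr_ge0 ?tail_ge0// ler_expR; lra.
have cexp0 (x : R) : (0 <= c%:E * (expR (2 * x)%R)%:E)%E.
  by rewrite -EFinM lee_fin mulr_ge0 ?expR_ge0.
have mexp := measurable_expR_scale (2 : R).
rewrite ge0_integralD//; [|by move=> x _; rewrite lee_fin tail_ge0|exact: measurable_funeM].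
rewrite ge0_integralZl_EFin//.
rewrite [X in (X + _)%E](_ : _ = (rho (t - A))%:E); last first.
  by rewrite -[RHS]mule1 -(probability_setT M) -integral_cst.
rewrite EFinD leeD2l//.
have -> : D * C * k * expR (- A) * H t = c * k by rewrite /c; ring.
by rewrite [leRHS]EFinM lee_wpmul2l ?lee_fin.
Qed.

End compound_poisson_tail.

(** * Polynomial approximation of a step function on [0, 1] *)

Section step_polynomial.
Context {R : realType}.

(** With the lower inequality that follows, the size of (1 - z)^m is decided by m z. For m = 2^n and
    z = y^n this product is (2 y)^n, whence the threshold 1/2. *)
Lemma bernoulli_upper (z : R) m : 0 <= z <= 1 -> (1 - z) ^+ m * (1 + m%:R * z) <= 1.
Proof.
move=> /andP[z0 z1]; elim: m => [|m IH]; first by rewrite expr0 mul0r addr0 mulr1.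
apply: le_trans IH; rewrite exprSr -mulrA ler_wpM2l ?exprn_ge0 ?subr_ge0//.
rewrite -natr1; have : 0 <= (m%:R + 1) * z * z :> R by rewrite !mulr_ge0// addr_ge0.
nra.
Qed.

Lemma bernoulli_lower (z : R) m : 0 <= z <= 1 -> 1 - m%:R * z <= (1 - z) ^+ m.
Proof.
move=> /andP[z0 z1]; elim: m => [|m IH]; first by rewrite expr0 mul0r subr0.
have : 0 <= m%:R * z * z :> R by rewrite !mulr_ge0.
rewrite exprSr -natr1; nra.
Qed.

Lemma expr_small (z e : R) : 0 <= z < 1 -> 0 < e -> \forall n \near \oo, z ^+ n <= e.
Proof.
move=> /andP[z0 z1] e0.
have /cvgrPdist_le/(_ _ e0) : z ^+ n @[n --> \oo] --> (0 : R).
  by apply: cvg_expr; rewrite ger0_norm.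
by apply: filterS => n; rewrite sub0r normrN ger0_norm// exprn_ge0.
Qed.

(* The polynomials (1 - y^n)^(2^n) converge to the indicator of y < 1/2. *)
Lemma step_polynomial (al be e : R) : 0 <= al < 1 / 2 -> 1 / 2 < be -> 0 < e ->
  exists p : {poly R}, [/\ forall y, 0 <= y <= 1 -> 0 <= p.[y] <= 1,
    forall y, 0 <= y <= al -> 1 - e <= p.[y] &
    forall y, be <= y <= 1 -> p.[y] <= e].
Proof.
move=> /andP[al0 al1] be1 e0.
have [n [n1 n2]] : exists n, (2 * al) ^+ n <= e /\ (2 * be)^-1 ^+ n <= e.
  near \oo => n; exists n; split; near: n; apply: expr_small => //.
    by apply/andP; split; lra.
  rewrite invr_ge0; apply/andP; split; first by lra.
  by rewrite invf_lt1; lra.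
pose p : {poly R} := (1 - 'X^n) ^+ (2 ^ n).
have pE y : p.[y] = (1 - y ^+ n) ^+ (2 ^ n).
  by rewrite /p !hornerE.
have yn (y : R) : 0 <= y <= 1 -> 0 <= y ^+ n <= 1.
  by move=> /andP[y0 y1]; rewrite exprn_ge0// exprn_ile1.
exists p; split => y.
- move=> /yn/andP[y0 y1]; rewrite pE exprn_ge0 ?subr_ge0//=.
  by rewrite exprn_ile1 ?subr_ge0// gerBl.
- move=> /andP[y0 y1]; rewrite pE.
  apply: le_trans (bernoulli_lower _ _ _); last by apply: yn; apply/andP; split; lra.
  rewrite lerD2l lerN2 natrX -exprMn; apply: le_trans n1.
  by rewrite lerXn2r ?nnegrE//; lra.
- move=> /andP[y0 y1]; rewrite pE.
  have y01 : 0 <= y <= 1 by apply/andP; split; lra.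
  have := bernoulli_upper _ (2 ^ n) (yn y y01).
  rewrite natrX -exprMn => h.
  have h2 : (2 * be) ^+ n <= (2 * y) ^+ n.
    by rewrite lerXn2r ?nnegrE//; lra.
  have b0 : 0 < (2 * be) ^+ n by rewrite exprn_gt0//; lra.
  apply: le_trans n2; rewrite exprVn -[leRHS]mul1r ler_pdivlMr//.
  apply: le_trans h; rewrite ler_wpM2l//; last by lra.
  by rewrite exprn_ge0// subr_ge0; case/andP: (yn y y01).
Unshelve. all: by end_near. Qed.

End step_polynomial.

(** * Polynomials in a random variable with values in [0, 1] *)

Section moments.
Context {R : realType} d (T : measurableType d) (P : probability T R) (Y : T -> R).
Hypothesis mY : measurable_fun setT Y.
Hypothesis Y01 : forall x, 0 <= Y x <= 1.

Lemma measurable_horner (p : {poly R}) : measurable_fun setT (fun x => p.[Y x]).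
Proof.
under eq_fun do rewrite horner_coef.
apply: measurable_sum => i; apply: measurable_funM => //.
exact: measurable_funX.
Qed.

Lemma integrable_horner (p : {poly R}) : P.-integrable setT (EFin \o (fun x => p.[Y x])).
Proof.
apply: (@integrable_bounded _ _ _ _ _ (\sum_(i < size p) `|p`_i|)).
  exact: measurable_horner.
move=> x; rewrite horner_coef; apply: (le_trans (ler_norm_sum _ _ _)).
apply: ler_sum => i _; rewrite normrM ler_piMr//.
have /andP[Y0 Y1] := Y01 x.
by rewrite ger0_norm ?exprn_ge0// exprn_ile1.
Qed.

(** For Y = e^(- lam X) the moments on the right are values of the Laplace transform of X at
    multiples of lam; this is how its convergence reaches the step polynomials. *)
Lemma Rintegral_horner (p : {poly R}) :
  \int[P]_x p.[Y x] = \sum_(i < size p) p`_i * \int[P]_x (Y x ^+ i).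
Proof.
have iX i : P.-integrable setT (EFin \o (fun x => Y x ^+ i)).
  by have := integrable_horner 'X^i; under eq_fun do rewrite /= hornerXn.
rewrite /Rintegral; under eq_integral do rewrite horner_coef -sumEFin.
rewrite integral_sum//; last first.
  move=> i; have := integrableZl measurableT p`_i (iX i).
  by under eq_fun do rewrite -EFinM.
rewrite (eq_bigr (fun i : 'I_(size p) =>
    (p`_i * fine (\int[P]_x (Y x ^+ i)%:E)%E)%:E)).
  by rewrite sumEFin.
move=> i _; rewrite EFinM fineK; last by apply: integrable_fin_num => //; exact: iX.
under eq_integral do rewrite EFinM.
by rewrite integralZl//; exact: iX.
Qed.

(** The constant c carries the error term of the two comparisons below. *)
Let prob_preimage (A : set R) (c : R) : measurable A ->
  P.-integrable setT (EFin \o (fun x => \1_A (Y x) + c)) /\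
  \int[P]_x (\1_A (Y x) + c) = fine (P (Y @^-1` A)) + c.
Proof.
move=> mA.
have mA' : measurable (Y @^-1` A) by rewrite -[X in measurable X]setTI; exact: mY.
have i1 : P.-integrable setT (EFin \o (fun x => \1_A (Y x))).
  apply: (@integrable_bounded _ _ _ _ _ 1).
    by apply: measurableT_comp => //; exact: measurable_indic.
  by move=> x; rewrite indicE; case: (_ \in _); rewrite ?normr1 ?normr0.
have i2 : P.-integrable setT (EFin \o (fun _ : T => c)).
  by apply: (@integrable_bounded _ _ _ _ _ `|c|).
split.
  rewrite (_ : EFin \o _ = ((EFin \o (fun x : T => \1_A (Y x))) \+
     (EFin \o (fun x : T => c)))%E) //.
  exact: integrableD.
rewrite RintegralD// Rintegral_probability_cst; congr (_ + _).
rewrite /Rintegral; congr fine.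
by have := integral_indic P measurableT mA'; rewrite setIT => <-.
Qed.

Lemma step_lower (p : {poly R}) (al e : R) :
  (forall y, 0 <= y <= 1 -> 0 <= p.[y] <= 1) ->
  (forall y, 0 <= y <= al -> 1 - e <= p.[y]) -> 0 <= e ->
  fine (P (Y @^-1` `]-oo, al])) - e <= \int[P]_x p.[Y x].
Proof.
move=> p01 pal e0.
have [i1 <-] := prob_preimage _ (- e) (measurable_itv `]-oo, al]).
apply: le_Rintegral => //; first exact: integrable_horner.
move=> x _; rewrite indicE mem_setE in_itv/=.
have /andP[Y0 Y1] := Y01 x.
have [h|h] := leP (Y x) al; first by rewrite pal// Y0.
have /andP[+ _] := p01 _ (Y01 x); rewrite /=; lra.
Qed.

Lemma step_upper (p : {poly R}) (be e : R) :
  (forall y, 0 <= y <= 1 -> 0 <= p.[y] <= 1) ->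
  (forall y, be <= y <= 1 -> p.[y] <= e) -> 0 <= e ->
  \int[P]_x p.[Y x] <= fine (P (Y @^-1` `]-oo, be[)) + e.
Proof.
move=> p01 pbe e0.
have [i1 <-] := prob_preimage _ e (measurable_itv `]-oo, be[).
apply: le_Rintegral => //; first exact: integrable_horner.
move=> x _; rewrite indicE mem_setE in_itv/=.
have /andP[Y0 Y1] := Y01 x.
have [h|h] := ltP (Y x) be; last by rewrite /= add0r pbe// h.
have /andP[_] := p01 _ (Y01 x); rewrite /=; lra.
Qed.

End moments.

(** * From convergence of Laplace transforms to comparison of tails *)

Lemma measurable_expeR (R : realType) : measurable_fun [set: \bar R] (@expeR R).
Proof.
move=> mD; apply: (measurability _ (ErealGenCInfty.measurableE R)) => //.
move=> _ [_ [r ->] <-]; rewrite setTI.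
have [r0|r0] := leP r 0.
  rewrite (_ : _ @^-1` _ = setT)//; apply/seteqP; split => // x _ /=.
  by rewrite in_itv/= andbT (@le_trans _ _ 0%E)// expeR_ge0.
rewrite (_ : _ @^-1` _ = `[(ln r)%:E, +oo[%classic); first exact: emeasurable_itv.
have E x : ((ln r)%:E <= x)%E = (r%:E <= expeR x)%E.
  by rewrite -lee_expeR /= lnK.
by apply/seteqP; split => x /=; rewrite !in_itv/= !andbT E.
Qed.

Section laplace_comparison.
Context {R : realType} d (T : measurableType d) (P : probability T R)
  (tau : T -> \bar R) (M : nat -> probability R R).
Hypothesis mtau : measurable_fun setT tau.
Hypothesis tau_ge0 : forall w, (0 <= tau w)%E.
Hypothesis M_neg0 : forall k, M k `]-oo, 0[%classic = 0%E.
Hypothesis laplace_cvg : forall lam : R, 0 < lam ->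
  fine (exp_integral (M k) (- lam)) @[k --> \oo] -->
  fine (\int[P]_w expeR (- (lam%:E * tau w)))%E.

Let Y (lam : R) (w : T) : R := fine (expeR (- (lam%:E * tau w))%E).
(** Replacing x by its positive part keeps Z in [0, 1] everywhere and changes no integral, since the
    laws [M k] do not charge the negative half-line. *)
Let Z (lam x : R) : R := expR (- (lam * Num.max x 0)).

Let mY lam : measurable_fun setT (Y lam).
Proof.
apply: measurableT_comp; first exact: fine_measurable.
apply: measurableT_comp; first exact: measurable_expeR.
apply: measurableT_comp; first exact: oppe_measurable.
exact: measurable_funeM.
Qed.

Let mZ lam : measurable_fun setT (Z lam).
Proof.
apply: measurableT_comp => //; apply: measurableT_comp => //.
by apply: measurable_funM => //; exact: measurable_maxr.
Qed.

Let YE lam w : 0 <= lam -> ((Y lam w)%:E = expeR (- (lam%:E * tau w)))%E.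
Proof.
move=> lam0; rewrite fineK// /=.
have : (- (lam%:E * tau w) <= 0)%E by rewrite leeNl oppe0 mule_ge0.
by case: (- _)%E => //=.
Qed.

Let Y01 lam w : 0 <= lam -> 0 <= Y lam w <= 1.
Proof.
move=> lam0; rewrite -2!lee_fin YE// expeR_ge0/=.
by rewrite -expeR0 lee_expeR leeNl oppe0 mule_ge0.
Qed.

Let Z01 lam x : 0 <= lam -> 0 <= Z lam x <= 1.
Proof.
move=> lam0; rewrite expR_ge0/= -expR0 ler_expR oppr_le0 mulr_ge0//.
by rewrite le_max lexx orbT.
Qed.

(** Where tau is +oo, both sides are 0 if n and lam are positive; they are 1 if n = 0 or lam = 0,
    because 0 times +oo is 0 in the extended reals. *)
Let YX lam w n : 0 <= lam -> Y lam w ^+ n = Y (n%:R * lam) w.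
Proof.
move=> lam0; have := tau_ge0 w; rewrite /Y.
case: (tau w) => [r| |]//= r0.
  by rewrite -expRM_natl mulrN mulrA.
have [->|lam_neq0] := eqVneq lam 0.
  by rewrite mulr0 mul0e oppe0 expeR0/= expr1n.
have lam_gt0 : 0 < lam by rewrite lt_neqAle eq_sym lam_neq0.
case: n => [|n]; first by rewrite expr0 mul0r mul0e oppe0 expeR0.
by rewrite !gt0_muley ?lte_fin ?mulr_gt0//= expr0n.
Qed.

Let ZX lam x n : Z lam x ^+ n = Z (n%:R * lam) x.
Proof. by rewrite /Z -expRM_natl mulrN mulrA. Qed.

Let Rintegral_Z k lam : \int[M k]_x Z lam x = fine (exp_integral (M k) (- lam)).
Proof.
rewrite /Rintegral /exp_integral; congr fine.
have mN : measurable (`]-oo, 0[ : set R) by [].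
have m1 : measurable_fun setT (fun x => (Z lam x)%:E) by exact/measurable_EFinP.
have p1 x : (0 <= (Z lam x)%:E)%E by rewrite lee_fin expR_ge0.
have m2 := measurable_expR_scale (- lam).
have p2 x : (0 <= (expR (- lam * x)%R)%:E)%E by rewrite lee_fin expR_ge0.
have Mk0 := M_neg0 k.
rewrite (ge0_negligible_integral mN measurableT m1 (fun x _ => p1 x) Mk0).
rewrite (ge0_negligible_integral mN measurableT m2 (fun x _ => p2 x) Mk0).
apply: eq_integral => x; rewrite inE/= in_itv/= => -[_ /negP]; rewrite -leNgt => x0.
by rewrite /Z (max_idPl x0) mulNr.
Qed.

Let moment_cvg lam n : 0 < lam ->
  \int[M k]_x (Z lam x ^+ n) @[k --> \oo] --> \int[P]_w (Y lam w ^+ n).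
Proof.
(* Order 0 would be the Laplace transform at 0, outside [laplace_cvg]; it is the total mass. *)
move=> lam0; have lamW := ltW lam0; case: n => [|n].
  under eq_cvg do rewrite Rintegral_probability_cst.
  by rewrite Rintegral_probability_cst; exact: cvg_cst.
have nlam : 0 < n.+1%:R * lam by rewrite mulr_gt0.
rewrite (_ : \int[P]_w (Y lam w ^+ n.+1) =
    fine (\int[P]_w expeR (- ((n.+1%:R * lam)%:E * tau w)))%E); last first.
  by rewrite /Rintegral; congr fine; apply: eq_integral => w _; rewrite YX// YE// ltW.
rewrite (_ : (fun k => _) = (fun k => fine (exp_integral (M k) (- (n.+1%:R * lam))))).
  exact: laplace_cvg.
apply/funext => k; rewrite -Rintegral_Z.
by apply: eq_Rintegral => x _; rewrite ZX.
Qed.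

Let horner_cvg lam (p : {poly R}) : 0 < lam ->
  \int[M k]_x p.[Z lam x] @[k --> \oo] --> \int[P]_w p.[Y lam w].
Proof.
move=> lam0; have lamW := ltW lam0.
rewrite Rintegral_horner//; last by move=> w; exact: Y01.
rewrite (_ : (fun k => _) = (fun k => \sum_(i < size p) p`_i * \int[M k]_x (Z lam x ^+ i))).
  apply: cvg_big => [|i _]; first exact: add_continuous.
  apply: cvgM; first exact: cvg_cst.
  exact: moment_cvg.
apply/funext => k; rewrite Rintegral_horner// => x; exact: Z01.
Qed.

(** The rate at which e^(- lambda x) crosses the threshold 1/2 of the step polynomials exactly at x
    = s. *)
Let lambda (s : R) := ln 2 / s.
Let lambda_gt0 s : 0 < s -> 0 < lambda s.
Proof. by move=> s0; rewrite divr_gt0// ln_gt0// ltr1n. Qed.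

Let half_exp s : 0 < s -> expR (- (lambda s * s)) = 1 / 2.
Proof. by move=> s0; rewrite divfK ?gt_eqF// expRN lnK ?posrE// div1r. Qed.

Let Y_le lam u w : 0 < lam -> (Y lam w <= expR (- (lam * u))) = (u%:E <= tau w)%E.
Proof.
move=> lam0; have lamW := ltW lam0; rewrite -lee_fin YE//.
have -> : ((expR (- (lam * u)))%:E = expeR (- (lam%:E * u%:E)))%E by [].
by rewrite lee_expeR leeN2 lee_pmul2l// lte_fin.
Qed.

Let Y_lt lam u w : 0 < lam -> (Y lam w < expR (- (lam * u))) = (u%:E < tau w)%E.
Proof.
move=> lam0; have lamW := ltW lam0; rewrite -lte_fin YE//.
have -> : ((expR (- (lam * u)))%:E = expeR (- (lam%:E * u%:E)))%E by [].
by rewrite lte_expeR lteN2 lte_pmul2l// lte_fin.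
Qed.

(** The step is placed at the midpoint u of r and s, so that e^(- lam s) < 1/2 < e^(- lam r), and
    the behaviour of the polynomial in between is irrelevant. The three errors e / 3 come from the
    two polynomial comparisons and from the convergence in k. *)
Lemma prob_ge_le_tail (s r e : R) : 0 <= r < s -> 0 < e ->
  \forall k \near \oo, fine (P [set w | (s%:E <= tau w)%E]) <= tail (M k) r + e.
Proof.
move=> /andP[r0 rs] e0.
pose u := (r + s) / 2.
have u0 : 0 < u by rewrite /u; lra.
pose lam := lambda u.
have lam0 : 0 < lam by exact: lambda_gt0.
have e30 : 0 < e / 3 by rewrite divr_gt0.
have al01 : 0 <= expR (- (lam * s)) < 1 / 2.
  rewrite expR_ge0/= -(half_exp _ u0) ltr_expR ltrN2 ltr_pM2l//.
  by rewrite /u; lra.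
have be1 : 1 / 2 < expR (- (lam * r)).
  rewrite -(half_exp _ u0) ltr_expR ltrN2 ltr_pM2l//.
  by rewrite /u; lra.
have [p [p01 p1 p2]] := step_polynomial _ _ _ al01 be1 e30.
have hc := horner_cvg lam p lam0.
near=> k.
have hk : `|\int[P]_w p.[Y lam w] - \int[M k]_x p.[Z lam x]| <= e / 3.
  by near: k; move/cvgrPdist_le : hc; apply.
have := @step_lower _ _ _ P _ (mY lam) (fun w => Y01 lam w (ltW lam0)) p _ _ p01 p1 (ltW e30).
have := @step_upper _ _ _ (M k) _ (mZ lam) (fun w => Z01 lam w (ltW lam0)) p _ _ p01 p2 (ltW e30).
rewrite (_ : Z lam @^-1` `]-oo, expR (- (lam * r))[ = `]r, +oo[%classic); last first.
  apply/seteqP; split => x /=; rewrite !in_itv/= andbT /Z ltr_expR ltrN2 ltr_pM2l// lt_max.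
    by move=> /orP[//|]; lra.
  by move=> ->.
rewrite (_ : Y lam @^-1` `]-oo, expR (- (lam * s))] = [set w | (s%:E <= tau w)%E]); last first.
  by apply/seteqP; split => w /=; rewrite !in_itv/= Y_le.
rewrite -/(tail (M k) r).
move: hk; rewrite ler_norml => /andP[]; lra.
Unshelve. all: by end_near. Qed.

Lemma tail_le_prob_ge (s r e : R) : 0 <= r < s -> 0 < e ->
  \forall k \near \oo, tail (M k) s <= fine (P [set w | (r%:E <= tau w)%E]) + e.
Proof.
move=> /andP[r0 rs] e0.
pose u := (r + s) / 2.
have u0 : 0 < u by rewrite /u; lra.
pose lam := lambda u.
have lam0 : 0 < lam by exact: lambda_gt0.
have e30 : 0 < e / 3 by rewrite divr_gt0.
have al01 : 0 <= expR (- (lam * s)) < 1 / 2.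
  rewrite expR_ge0/= -(half_exp _ u0) ltr_expR ltrN2 ltr_pM2l//.
  by rewrite /u; lra.
have be1 : 1 / 2 < expR (- (lam * r)).
  rewrite -(half_exp _ u0) ltr_expR ltrN2 ltr_pM2l//.
  by rewrite /u; lra.
have [p [p01 p1 p2]] := step_polynomial _ _ _ al01 be1 e30.
have hc := horner_cvg lam p lam0.
near=> k.
have hk : `|\int[P]_w p.[Y lam w] - \int[M k]_x p.[Z lam x]| <= e / 3.
  by near: k; move/cvgrPdist_le : hc; apply.
have := @step_upper _ _ _ P _ (mY lam) (fun w => Y01 lam w (ltW lam0)) p _ _ p01 p2 (ltW e30).
have := @step_lower _ _ _ (M k) _ (mZ lam) (fun w => Z01 lam w (ltW lam0)) p _ _ p01 p1 (ltW e30).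
have h1 : tail (M k) s <= fine (M k (Z lam @^-1` `]-oo, expR (- (lam * s))])).
  apply: fine_le; rewrite ?fin_num_measure//.
    by rewrite -[X in measurable X]setTI; exact: mZ.
  apply: le_measure; rewrite ?inE//.
    by rewrite -[X in measurable X]setTI; exact: mZ.
  move=> x /=; rewrite !in_itv/= andbT /Z => sx.
  by rewrite ler_expR lerN2 ler_pM2l// le_max (ltW sx).
have h2 : fine (P (Y lam @^-1` `]-oo, expR (- (lam * r))[)) <=
    fine (P [set w | (r%:E <= tau w)%E]).
  have mr : measurable [set w | (r%:E <= tau w)%E].
    rewrite (_ : [set w | _] = Y lam @^-1` `]-oo, expR (- (lam * r))]).
      by rewrite -[X in measurable X]setTI; exact: mY.
    by apply/seteqP; split => w /=; rewrite !in_itv/= Y_le.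
  apply: fine_le; rewrite ?fin_num_measure//.
    by rewrite -[X in measurable X]setTI; exact: mY.
  apply: le_measure; rewrite ?inE//.
    by rewrite -[X in measurable X]setTI; exact: mY.
  by move=> w /=; rewrite in_itv/= Y_lt// => /ltW.
move: hk; rewrite ler_norml => /andP[]; lra.
Unshelve. all: by end_near. Qed.

End laplace_comparison.

(** * Jump laws obtained by normalizing a restriction of a measure *)

Section jump_law.
Context {R : realType}.

Lemma probability_tail_unique (M N : probability R R) :
  (forall t, tail M t = tail N t) -> forall A, measurable A -> M A = N A.
Proof.
move=> MN; apply: (measure_unique (@RGenOInfty.G R) (fun n => `](- n%:R), +oo[%classic)).
- exact: RGenOInfty.measurableE.
- move=> _ _ [x ->] [y ->]; exists (Num.max x y).
  by apply/seteqP; split => z /=; rewrite !in_itv/= !andbT gt_max => /andP.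
- by move=> n; exists (- n%:R).
- apply/seteqP; split => // x _; exists (Num.truncn `|x|).+1 => //=.
  rewrite in_itv/= andbT ltrNl (le_lt_trans _ (truncnS_gt _))//.
  by rewrite -normrN ler_norm.
- by move=> _ [x ->]; rewrite -[LHS]tailE -[RHS]tailE MN.
- by move=> n; rewrite (le_lt_trans (probability_le1 _ _))// ltry.
Qed.

(* The law of a jump in D; when nu D = 0 it is the Dirac mass at 0. *)
Lemma jump_law (nu : {measure set R -> \bar R}) (D E : set R) :
  measurable D -> measurable E -> D `<=` E -> E 0 -> (nu D < +oo)%E ->
  exists2 Q : probability R R, Q (~` E) = 0%E &
    forall f, measurable_fun setT f -> (forall x, 0 <= f x)%E ->
      ((fine (nu D))%:E * \int[Q]_x f x = \int[nu]_(x in D) f x)%E.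
Proof.
move=> mD mE DE E0 Dfin.
have mCE : measurable (~` E) by exact: measurableC.
have fD : nu D \is a fin_num by rewrite ge0_fin_numE.
have [nuD0|nuD0] := eqVneq (nu D) 0%E.
  exists (@dirac _ R 0 R); first by rewrite /= diracE memNset.
  move=> f mf f0; rewrite nuD0 mul0e null_set_integral//.
  exact: measurable_funTS.
pose Q : probability R R := mnormalize (mrestr nu mD) (@dirac _ R 0 R).
have QE A : measurable A -> (Q A = nu (A `&` D) * (fine (nu D))^-1%:E)%E.
  move=> mA; have DT : mrestr nu mD setT = nu D by rewrite /mrestr setTI.
  rewrite /Q /= /mnormalize/= DT (negbTE nuD0)/=.
  by case: ifPn => // /eqP h; rewrite h in Dfin.
have nuD_gt0 : 0 < fine (nu D) by rewrite fine_gt0// Dfin andbT lt0e nuD0/=.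
exists Q.
  rewrite QE// (_ : _ `&` D = set0) ?measure0 ?mul0e//.
  by apply/seteqP; split => // x [+ /DE].
move=> f mf f0.
pose c := NngNum (ltW nuD_gt0).
have mCD : measurable (~` D) by exact: measurableC.
have QC : Q (~` D) = 0%E by rewrite QE// setICl measure0 mul0e.
rewrite (ge0_negligible_integral mCD measurableT mf (fun x _ => f0 x) QC).
rewrite setTD setCK -[_%:E]/(c%:num%:E) -ge0_integral_mscale//; last exact: measurable_funTS.
apply: eq_measure_integral => A mA AD.
transitivity ((fine (nu D))%:E * Q A)%E => //.
rewrite QE// (setIidl AD) muleCA -EFinM mulfV ?mule1//.
by rewrite gt_eqF.
Qed.

Lemma exp_integral_le (Q : probability R R) (E : set R) (s B : R) :
  measurable E -> Q (~` E) = 0%E -> 0 <= B ->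
  (forall x, E x -> expR (s * x) <= B) -> (exp_integral Q s <= B%:E)%E.
Proof.
move=> mE QE B0 EB; have mCE : measurable (~` E) by exact: measurableC.
have ms := measurable_expR_scale s.
have p0 x : (0 <= (expR (s * x)%R)%:E)%E by rewrite lee_fin expR_ge0.
rewrite /exp_integral (ge0_negligible_integral mCE measurableT ms (fun x _ => p0 x) QE).
rewrite setTD setCK.
apply: (@le_trans _ _ (\int[Q]_(x in E) (cst B%:E x))%E).
  apply: ge0_le_integral => //; first exact: measurable_funTS.
by rewrite integral_cst// -[leRHS]mule1 lee_wpmul2l// ?lee_fin// probability_le1.
Qed.

End jump_law.

(** * Approximation of the Lévy exponent by compound Poisson laws *)

Section levy_measure.
Context {R : realType} (nu : {measure set R -> \bar R}).
Hypothesis levy_int : (\int[nu]_(v in `]0%R, +oo[) (Num.min 1%R v)%:E < +oo)%E.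

Let I : R := fine (\int[nu]_(v in `]0%R, +oo[) (Num.min 1%R v)%:E)%E.

Let mmin : measurable_fun setT (fun v : R => (Num.min 1%R v)%:E).
Proof. by apply/measurable_EFinP; exact: measurable_minr. Qed.

Let min_ge0 (v : R) : v \in `]0%R, +oo[ -> (0 <= (Num.min 1%R v)%:E)%E.
Proof. by rewrite in_itv/= andbT lee_fin le_min ler01 => /ltW. Qed.

(** A Chebyshev bound: min(1, v) is at least e on D. *)
Lemma levy_fin (D : set R) (e : R) : measurable D -> 0 < e -> e <= 1 ->
  D `<=` `]e, +oo[ -> (nu D < +oo)%E.
Proof.
move=> mD e0 e1 De.
have D0 : D `<=` `]0, +oo[.
  by move=> x /De/=; rewrite !in_itv/= !andbT; exact: lt_trans.
have : (e%:E * nu D <= \int[nu]_(v in `]0%R, +oo[) (Num.min 1%R v)%:E)%E.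
  rewrite -integral_cst//.
  apply: (@le_trans _ _ (\int[nu]_(v in D) (Num.min 1%R v)%:E)%E).
    apply: ge0_le_integral => //.
    - by move=> x _; rewrite lee_fin ltW.
    - exact: measurable_funTS.
    - move=> x /De/=; rewrite in_itv/= andbT lee_fin le_min e1 => /ltW //.
  apply: ge0_subset_integral => //; first exact: measurable_funTS.
move=> /le_lt_trans/(_ levy_int).
have := measure_ge0 nu D; case: (nu D) => // [r _ _|_]; first exact: ltry.
by rewrite gt0_muley ?lte_fin.
Qed.

Lemma levy_expR_integral_fin (lam : R) : 0 < lam ->
  (\int[nu]_(v in `]0%R, +oo[) (1 - expR (- (lam * v)))%:E < +oo)%E.
Proof.
move=> lam0.
apply: (@le_lt_trans _ _ (\int[nu]_(v in `]0%R, +oo[) ((1 + lam)%:E * (Num.min 1%R v)%:E))%E).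
  apply: ge0_le_integral => //.
  - move=> x /=; rewrite in_itv/= andbT lee_fin subr_ge0 -expR0 ler_expR => x0.
    by rewrite oppr_le0 mulr_ge0// ltW.
  - apply: measurable_funTS; apply/measurable_EFinP.
    apply: measurable_funB => //; apply: measurableT_comp => //.
    by apply: measurableT_comp => //; exact: measurable_funM.
  - by apply: measurable_funTS; exact: measurable_funeM.
  move=> x /=; rewrite in_itv/= andbT -EFinM lee_fin => x0.
  have h1 : 1 - expR (- (lam * x)) <= 1 by rewrite gerBl expR_ge0.
  have h2 : 1 - expR (- (lam * x)) <= lam * x.
    by have := expR_ge1Dx (- (lam * x)); lra.
  by rewrite /Num.min; case: ifP => _; nra.
rewrite ge0_integralZl_EFin//; last 2 first.
  exact: measurable_funTS.
  by rewrite addr_ge0// ltW.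
by apply: lte_mul_pinfty => //; rewrite lee_fin addr_ge0// ltW.
Qed.


(** The exponent is l times the integral of e^(s v) - 1 over D against nu: the normalization of the
    jump law disappears, and exponents over disjoint sets D add up. *)
Lemma compound_poisson_laplace (Q : probability R R) (D : set R) (l s : R) (a : {nonneg R}) :
  measurable D -> (nu D < +oo)%E ->
  (forall f, measurable_fun setT f -> (forall x, 0 <= f x)%E ->
      ((fine (nu D))%:E * \int[Q]_x f x = \int[nu]_(x in D) f x)%E) ->
  exp_integral Q s \is a fin_num -> a%:num = l * fine (nu D) ->
  exp_integral (compound_poisson a Q) s =
  (expR (l * (fine (\int[nu]_(v in D) (expR (s * v)%R)%:E)%E - fine (nu D))))%:E.
Proof.
move=> mD Dfin QD Qfin aE; rewrite exp_integral_compound_poisson// aE; congr (expR _)%:E.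
rewrite -mulrA mulrBr mulr1; congr (_ * (_ - _)).
have <- := QD _ (measurable_expR_scale s) _; last first.
  by move=> x; rewrite lee_fin expR_ge0.
by rewrite fineM.
Qed.

(** For k = 0 the cut is at 1 and the set of small jumps is empty, a case which the Dirac mass in
    [jump_law] covers. *)
Let e_ (k : nat) : R := k.+1%:R^-1.
Let e_gt0 k : 0 < e_ k. Proof. by rewrite invr_gt0. Qed.
Let e_le1 k : e_ k <= 1. Proof. by rewrite invf_le1// ler1n. Qed.

Let mexp1 lam : measurable_fun setT (fun v : R => (1 - expR (- (lam * v)))%:E).
Proof.
apply/measurable_EFinP.
apply: measurable_funB => //; apply: measurableT_comp => //.
by apply: measurableT_comp => //; exact: measurable_funM.
Qed.

Let exp1_ge0 lam (v : R) : 0 < lam -> 0 <= v -> (0 <= (1 - expR (- (lam * v)))%:E)%E.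
Proof.
by move=> lam0 v0; rewrite lee_fin subr_ge0 -expR0 ler_expR oppr_le0 mulr_ge0// ltW.
Qed.

Lemma expR_integral_fin_num (D : set R) (lam : R) : measurable D ->
  D `<=` `]0, +oo[ -> 0 < lam ->
  (\int[nu]_(v in D) (1 - expR (- (lam * v)))%:E)%E \is a fin_num.
Proof.
move=> mD D0 lam0.
rewrite ge0_fin_numE; last first.
  by apply: integral_ge0 => v /D0/=; rewrite in_itv/= andbT => /ltW; exact: exp1_ge0.
apply: le_lt_trans (levy_expR_integral_fin lam lam0).
apply: ge0_subset_integral => //; first exact: measurable_funTS.
by move=> x; rewrite /= in_itv/= andbT => /ltW; exact: exp1_ge0.
Qed.

Lemma expR_integral_compl (D : set R) (lam : R) : measurable D ->
  (nu D < +oo)%E -> D `<=` `]0, +oo[ -> 0 < lam ->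
  fine (\int[nu]_(v in D) (expR (- lam * v)%R)%:E)%E - fine (nu D) =
  - fine (\int[nu]_(v in D) (1 - expR (- (lam * v)))%:E)%E.
Proof.
move=> mD Dfin D0 lam0.
have Dge0 v : D v -> 0 <= v by move=> /D0/=; rewrite in_itv/= andbT => /ltW.
have i2 : (\int[nu]_(v in D) (expR (- lam * v)%R)%:E <= nu D)%E.
  rewrite -[leRHS]mul1e -integral_cst//; apply: ge0_le_integral => //.
  - exact: measurable_funTS (measurable_expR_scale (- lam)).
  - by move=> v /Dge0 v0; rewrite lee_fin -expR0 ler_expR mulNr oppr_le0 mulr_ge0// ltW.
have E : (\int[nu]_(v in D) (1 - expR (- (lam * v)))%:E +
    \int[nu]_(v in D) (expR (- lam * v)%R)%:E = nu D)%E.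
  have p1 : forall v, D v -> (0 <= (1 - expR (- (lam * v)))%:E)%E.
    by move=> v /Dge0; exact: exp1_ge0.
  have p2 : forall v, D v -> (0 <= (expR (- lam * v)%R)%:E)%E.
    by move=> v _; rewrite lee_fin expR_ge0.
  have m1 : measurable_fun D (fun v : R => (1 - expR (- (lam * v)))%:E) by exact: measurable_funTS.
  have m2 := measurable_funTS (D := D) (measurable_expR_scale (- lam)).
  rewrite -ge0_integralD//.
  rewrite -[RHS]mul1e -integral_cst//; apply: eq_integral => v _.
  by rewrite -EFinD mulNr subrK.
have f1 := expR_integral_fin_num D lam mD D0 lam0.
have f2 : (\int[nu]_(v in D) (expR (- lam * v)%R)%:E)%E \is a fin_num.
  by rewrite ge0_fin_numE ?(le_lt_trans i2)// integral_ge0// => v _; rewrite lee_fin expR_ge0.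
by rewrite -E (fineD f1 f2) opprD addrCA subrr addr0.
Qed.

Lemma expR_integral_approx (lam : R) : 0 < lam ->
  fine (\int[nu]_(v in `]e_ k, +oo[) (1 - expR (- (lam * v)))%:E)%E @[k --> \oo] -->
  fine (\int[nu]_(v in `]0%R, +oo[) (1 - expR (- (lam * v)))%:E)%E.
Proof.
move=> lam0; apply: fine_cvg; rewrite fineK; last first.
  rewrite ge0_fin_numE ?levy_expR_integral_fin//.
  by apply: integral_ge0 => v /=; rewrite in_itv/= andbT => /ltW; exact: exp1_ge0.
have -> : `]0%R, +oo[%classic = \bigcup_k `]e_ k, +oo[%classic :> set R.
  apply/seteqP; split => x /=.
    rewrite in_itv/= andbT => x0; exists (Num.truncn x^-1) => //=.
    rewrite in_itv/= andbT /e_ invf_plt ?posrE//.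
    exact: truncnS_gt.
  by move=> [k _] /=; rewrite !in_itv/= !andbT; exact: lt_trans.
apply: ge0_nondecreasing_set_cvg_integral => //.
- move=> m n mn; apply/subsetPset; apply: subset_itvr.
  by rewrite bnd_simp /e_ lef_pV2 ?posrE// ler_nat ltnS.
- by move=> k; exact: measurable_funTS.
- move=> k v /=; rewrite in_itv/= andbT => /(lt_trans (e_gt0 k))/ltW.
  exact: exp1_ge0.
Qed.

(** The exponents of the jumps in []e_ k, 1]] and in []1, +oo[] add up to an integral over []e_ k,
    +oo[], which increases to the full exponent by monotone convergence. The intensity of [S k] may
    diverge with k, but its exponential moment cannot, because e^(2 v) - 1 is of order v near 0 and
    min(1, v) is integrable. *)
Lemma levy_approximation (Q : probability R R) (l : R) (a : {nonneg R}) :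
  0 < l -> a%:num = l * fine (nu `]1, +oo[%classic) ->
  Q `]-oo, 0[%classic = 0%E ->
  (forall f, measurable_fun setT f -> (forall x, 0 <= f x)%E ->
      ((fine (nu `]1%R, +oo[%classic))%:E * \int[Q]_x f x =
       \int[nu]_(x in `]1%R, +oo[) f x)%E) ->
  exists (S : nat -> probability R R) (K : R),
  [/\ forall k, S k `]-oo, 0[%classic = 0%E,
      0 <= K, forall k, (exp_integral (S k) 2 <= K%:E)%E &
      forall lam, 0 < lam ->
        fine (exp_integral (convolution (S k) (compound_poisson a Q)) (- lam)) @[k --> \oo] -->
        expR (- (l * fine (\int[nu]_(v in `]0%R, +oo[) (1 - expR (- (lam * v)))%:E)%E))].
Proof.
move=> l0 aE Q0 QD1.
have D1fin : (nu `]1%R, +oo[%classic < +oo)%E by exact: (@levy_fin _ 1).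
pose D k : set R := `]e_ k, 1]%classic.
have Dk_sub k : D k `<=` `]e_ k, +oo[.
  by apply: subset_itvl; rewrite bnd_simp.
have Dfin k : (nu (D k) < +oo)%E.
  apply: (levy_fin _ (e_ k)); [exact: measurable_itv|exact: e_gt0|exact: e_le1|exact: Dk_sub].
have D0 k : D k `<=` `]0, +oo[.
  by move=> x /Dk_sub; rewrite /= !in_itv/= !andbT; exact: lt_trans.
pose E : set R := `[0, 1]%classic.
have DE k : D k `<=` E by apply: subset_itvr; rewrite bnd_simp; exact: ltW.
have E0 : E 0 by rewrite /E/= in_itv/= lexx/=.
have /choice[N NP] : forall k, exists M : probability R R, M (~` E) = 0%E /\
    forall f, measurable_fun setT f -> (forall x, 0 <= f x)%E ->
      ((fine (nu (D k)))%:E * \int[M]_x f x = \int[nu]_(x in D k) f x)%E.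
  move=> k.
  have [M ? ?] := jump_law nu (D k) E (measurable_itv _) (measurable_itv _) (DE k) E0 (Dfin k).
  by exists M.
have a_ge0 k : 0 <= l * fine (nu (D k)) by rewrite mulr_ge0 ?fine_ge0// ltW.
pose S k := compound_poisson (NngNum (a_ge0 k)) (N k).
have Nfin k s : exp_integral (N k) s \is a fin_num.
  rewrite ge0_fin_numE ?exp_integral_ge0//.
  have [NE _] := NP k.
  have : (exp_integral (N k) s <= (expR `|s|)%:E)%E.
    apply: (exp_integral_le (N k) E) ; [exact: measurable_itv|exact: NE|exact: expR_ge0|].
    move=> x; rewrite /E/= in_itv/= => /andP[x0 x1]; rewrite ler_expR.
    by rewrite (le_trans (ler_norm _))// normrM ler_piMr// ger0_norm.
  by move/le_lt_trans; apply; rewrite ltry.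
have SE k s : exp_integral (S k) s = (expR (l * (fine (\int[nu]_(v in D k) (expR (s * v)%R)%:E)%E
    - fine (nu (D k)))))%:E.
  have [_ ND] := NP k.
  by apply: compound_poisson_laplace => //; exact: measurable_itv.
(* For 0 < v <= 1 one has e^(2 v) - 1 <= 2 v e^(2 v) <= 2 e^2 min(1, v), whose integral is at most 2
   e^2 [I] for every k. *)
exists S, (expR (l * (2 * expR 2 * I))); split; last 1 first.
- move=> lam lam0.
  have Qfin : exp_integral Q (- lam) \is a fin_num.
    rewrite ge0_fin_numE ?exp_integral_ge0//.
    have mE : measurable (~` `]-oo, 0[ : set R) by exact: measurableC.
    have : (exp_integral Q (- lam) <= 1%:E)%E.
      apply: (exp_integral_le Q (~` `]-oo, 0[)) => //; first by rewrite setCK.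
      move=> x /=; rewrite in_itv/= => /negP; rewrite -leNgt => x0.
      by rewrite -expR0 ler_expR mulNr oppr_le0 mulr_ge0// ltW.
    by move/le_lt_trans; apply; rewrite ltry.
  have D10 : `]1%R, +oo[%classic `<=` (`]0, +oo[ : set R) by apply: subset_itvr; rewrite bnd_simp.
  rewrite (_ : (fun k => _) = (fun k => expR (- (l *
      fine (\int[nu]_(v in `]e_ k, +oo[) (1 - expR (- (lam * v)))%:E)%E)))); last first.
    apply/funext => k.
    rewrite exp_integral_convolution SE (compound_poisson_laplace Q `]1%R, +oo[%classic l (- lam) a)// /=.
    rewrite -expRD -mulrDr (expR_integral_compl (D k) lam (measurable_itv _) (Dfin k) (D0 k) lam0).
    rewrite (expR_integral_compl _ lam (measurable_itv _) D1fin D10 lam0) -opprD mulrN.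
    congr (expR (- (l * _))).
    have e0y : `]e_ k, +oo[%classic `<=` (`]0, +oo[ : set R).
      by apply: subset_itvr; rewrite bnd_simp ltW.
    rewrite -(fineD (expR_integral_fin_num _ lam (measurable_itv _) (D0 k) lam0)
      (expR_integral_fin_num _ lam (measurable_itv _) D10 lam0)); congr fine.
    have itvU : `]e_ k, +oo[%classic = `]e_ k, 1] `|` `]1, +oo[ :> set R.
      by rewrite -itv_bndbnd_setU// bnd_simp.
    rewrite itvU ge0_integral_setU//.
    - exact: measurable_funTS.
    - move=> x; rewrite -itvU => /e0y/=; rewrite in_itv/= andbT => /ltW.
      exact: exp1_ge0.
    - apply/disj_setPS => y [/=]; rewrite !in_itv/= andbT => /andP[_ y1].
      by rewrite ltNge y1.
  apply: (@continuous_cvg _ _ _ _ _ _ expR); first exact: continuous_expR.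
  apply: cvgN; apply: cvgM; first exact: cvg_cst.
  exact: expR_integral_approx.
- move=> k; apply: compound_poisson_neg0.
  have [NE _] := NP k; apply/eqP; rewrite eq_le measure_ge0 andbT -NE.
  apply: le_measure; rewrite ?inE//; first by apply: measurableC; exact: measurable_itv.
  by move=> x; rewrite /E/= !in_itv/= => x0 /andP[]; rewrite leNgt x0.
- exact: expR_ge0.
- move=> k; rewrite SE lee_fin ler_expR ler_wpM2l ?(ltW l0)// lerBlDr addrC.
  have c0 : 0 <= 2 * expR 2 :> R by rewrite mulr_ge0 ?expR_ge0.
  have Ifin : (\int[nu]_(v in `]0%R, +oo[) (Num.min 1%R v)%:E)%E \is a fin_num.
    by rewrite ge0_fin_numE//; apply: integral_ge0 => v; exact: min_ge0.
  have Dfink : nu (D k) \is a fin_num by rewrite ge0_fin_numE.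
  rewrite -lee_fin EFinD EFinM (fineK Dfink) (fineK Ifin).
  have mDk : measurable (D k) by exact: measurable_itv.
  have Dmin v : D k v -> (0 <= (Num.min 1%R v)%:E)%E.
    by move=> /D0 v0; exact: min_ge0.
  have mexp2 := measurable_funTS (D := D k) (measurable_expR_scale 2).
  have mmin2 : measurable_fun (D k) (fun v : R => ((2 * expR 2)%:E * (Num.min 1%R v)%:E)%E).
    by apply: measurable_funTS; exact: measurable_funeM.
  have cmin v : D k v -> (0 <= (2 * expR 2)%:E * (Num.min 1%R v)%:E)%E.
    by move=> /Dmin; apply: mule_ge0; rewrite lee_fin.
  have H : (\int[nu]_(v in D k) (expR (2 * v)%R)%:E <=
      \int[nu]_(v in D k) (cst 1%E v + (2 * expR 2)%:E * (Num.min 1%R v)%:E))%E.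
    apply: ge0_le_integral => //.
    - exact: emeasurable_funD.
    - move=> v; rewrite /D/= in_itv/= => /andP[ev v1].
      have v0 : 0 < v := lt_trans (e_gt0 k) ev.
      rewrite -EFinM -EFinD lee_fin (min_idPr v1).
      have h1 : expR (2 * v) * expR (- (2 * v)) = 1 :> R by rewrite expRxMexpNx_1.
      have h2 := expR_ge1Dx (- (2 * v)).
      have h3 : expR (2 * v) <= expR 2 :> R by rewrite ler_expR ler_piMr.
      have h4 := expR_gt0 (2 * v).
      have : expR (2 * v) * (1 - 2 * v) <= 1 by rewrite -[leRHS]h1 ler_pM2l.
      have : 2 * v * expR (2 * v) <= 2 * v * expR 2 by rewrite ler_wpM2l//; lra.
      by lra.
  have HI : (\int[nu]_(v in D k) (Num.min 1%R v)%:E <=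
      \int[nu]_(v in `]0%R, +oo[) (Num.min 1%R v)%:E)%E.
    apply: ge0_subset_integral => //; first exact: measurable_funTS.
  have HE : (\int[nu]_(v in D k) (expR (2 * v)%R)%:E <= nu (D k) +
       (2 * expR 2)%:E * \int[nu]_(v in `]0%R, +oo[) (Num.min 1%R v)%:E)%E.
    apply: (le_trans H); rewrite ge0_integralD// integral_cst// mul1e leeD2l//.
    rewrite ge0_integralZl_EFin//; last exact: measurable_funTS.
    by rewrite lee_wpmul2l// lee_fin.
  rewrite fineK//.
  rewrite ge0_fin_numE; last by apply: integral_ge0 => v _; rewrite lee_fin expR_ge0.
  apply: (le_lt_trans HE); rewrite lte_add_pinfty// lte_mul_pinfty//.
Qed.

End levy_measure.

(** * The event that the local time is small, through its inverse *)

Section inverse_local_time_event.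
Context {R : realType} (P : R -> probability (pathspace R) R)
  (m : {measure set R -> \bar R}) (L : R -> pathspace R -> R).
Hypothesis HL : local_time_at0 P m L.

(** Monotonicity of the trajectory gives one inclusion. The other uses its continuity: if L exceeds
    l at time t > 0, it already does so at some earlier time s, and the inverse is then at most s <
    t. *)
Lemma local_time_le_inverse (l t : R) : 0 <= l -> 0 < t ->
  [set w | L t w <= l] = [set w | (t%:E <= inverse_local_time L l w)%E].
Proof.
move=> l0 t0; apply/seteqP; split => w /=.
  move=> Ltl; apply: le_ereal_inf_tmp => _ [s [s0 ls] <-]; rewrite lee_fin leNgt.
  apply/negP => st; have := local_time_ndecr HL w s0 (ltW st).
  by move/(lt_le_trans ls); rewrite ltNge Ltl.
move=> tinf; rewrite leNgt; apply/negP => lLt.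
have Llt s : 0 <= s -> s < t -> L s w <= l.
  move=> s0 st; rewrite leNgt; apply/negP => lLs.
  have : (inverse_local_time L l w <= s%:E)%E by apply: ereal_inf_lbound; exists s.
  by move/(le_trans tinf); rewrite lee_fin leNgt st.
have Lcont := local_time_cont HL (w := w).
have [/(_ t) Lc _] := (continuous_within_itvcyP _ _).1 Lcont.
have Lnear : \forall s \near t, l < L s w.
  have Lct : L s w @[s --> t] --> L t w by apply: Lc; rewrite in_itv/= t0.
  exact: (cvgr_gt (L t w) Lct).
near t^'- => s.
have st : s < t by near: s; exact: nbhs_left_lt.
have s0 : 0 < s by near: s; exact: nbhs_left_gt.
have : l < L s w by near: s; exact: cvg_within Lnear.
by rewrite ltNge Llt// ltW.
Unshelve. all: by end_near. Qed.

Lemma inverse_local_time_ge0 (l : R) w : (0 <= inverse_local_time L l w)%E.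
Proof. by apply: le_ereal_inf_tmp => _ [s [s0 _] <-]; rewrite lee_fin. Qed.

Lemma measurable_inverse_local_time (l : R) : 0 <= l ->
  measurable_fun setT (inverse_local_time L l).
Proof.
move=> l0 mD; apply: (measurability _ (ErealGenCInfty.measurableE R)) => //.
move=> _ [_ [r ->] <-]; rewrite setTI.
have [r0|r0] := leP r 0.
  rewrite (_ : _ @^-1` _ = setT)//; apply/seteqP; split => // w _ /=.
  by rewrite in_itv/= andbT (@le_trans _ _ 0%E)// inverse_local_time_ge0.
rewrite (_ : _ @^-1` _ = [set w | L r w <= l]).
  rewrite -[X in measurable X]setTI (_ : [set w | _] = L r @^-1` `]-oo, l]).
    by apply: (local_time_meas HL (ltW r0)) => //; exact: measurable_itv.
  by apply/seteqP; split => w /=; rewrite in_itv.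
rewrite local_time_le_inverse//.
by apply/seteqP; split => w /=; rewrite in_itv/= andbT.
Qed.

End inverse_local_time_event.

(** * The law of the jumps larger than 1 under the subexponentiality assumption *)

Section subexponential_levy.
Context {R : realType} (nu : {measure set R -> \bar R}) (dF : probability R R).
Hypothesis levy_int : (\int[nu]_(v in `]0%R, +oo[) (Num.min 1%R v)%:E < +oo)%E.
Hypothesis FE : forall x, tail_df nu x = fine (dF `]-oo, x]%classic).
Hypothesis Fy : tail_df nu x @[x --> +oo] --> (1 : R).

Local Notation c := (fine (nu `]1, +oo[%classic)).

Lemma levy_tail1_fin : (nu `]1%R, +oo[%classic < +oo)%E.
Proof. by apply: (levy_fin nu levy_int _ 1). Qed.

(** If c were 0, division by zero would make [tail_df nu] identically 0, against its limit 1. *)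
Lemma levy_tail1_gt0 : 0 < c.
Proof.
rewrite lt_neqAle fine_ge0// andbT eq_sym; apply/eqP => c0.
have : tail_df nu x @[x --> +oo] --> (0 : R).
  rewrite (_ : tail_df nu = fun=> 0); first exact: cvg_cst.
  by apply/funext => x; rewrite /tail_df c0 invr0 mulr0.
move=> /(cvg_unique _ Fy) => /(_ (@norm_hausdorff _ _)) /eqP.
by rewrite oner_eq0.
Qed.

Lemma tail_dfE x : tail dF x = 1 - tail_df nu x.
Proof. by rewrite FE tail_cdf; ring. Qed.

Lemma tail_df_le0 : dF `]-oo, 0]%classic = 0%E.
Proof.
rewrite -[LHS]fineK ?fin_num_measure// -FE /tail_df set_itv_ge ?measure0 ?mul0r//.
by rewrite bnd_simp -leNgt.
Qed.

(** The assumption describes [dF] only through its distribution function. The normalized restriction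
    of nu to []1, +oo[] has the same one, hence is the same law. *)
Lemma tail_df_jump_law f : measurable_fun setT f -> (forall x, 0 <= f x)%E ->
  (c%:E * \int[dF]_x f x = \int[nu]_(x in `]1%R, +oo[) f x)%E.
Proof.
have c0 := levy_tail1_gt0.
have [Q Q0 QD] : exists2 Q : probability R R, Q (~` `[0, +oo[) = 0%E &
    forall f, measurable_fun setT f -> (forall x, 0 <= f x)%E ->
      (c%:E * \int[Q]_x f x = \int[nu]_(x in `]1%R, +oo[) f x)%E.
  apply: jump_law => //; last exact: levy_tail1_fin.
    by apply: subset_itvr; rewrite bnd_simp.
  by rewrite /= in_itv/= lexx.
move=> mf f0; rewrite -QD//; congr (_ * _)%E; apply: eq_measure_integral => A mA _.
apply: probability_tail_unique => // t.
suff : c * (1 - tail dF t) = c * (1 - tail Q t).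
  by move/(mulfI (lt0r_neq0 c0)); lra.
have mt : measurable_fun setT (fun x : R => (\1_(`]-oo, t] : set R) x : R)%:E).
  by apply/measurable_EFinP; exact: measurable_indic.
have p0 (x : R) : (0 <= (\1_(`]-oo, t] : set R) x : R)%:E :> \bar R)%E by rewrite lee_fin.
have H : (c%:E * Q `]-oo, t]%classic = nu `]1%R, t]%classic)%E.
  have := QD _ mt p0; rewrite !integral_indic// setIT => ->.
  rewrite (_ : _ `&` _ = `]1, t]%classic)//.
  by apply/seteqP; split => x /=; rewrite !in_itv/= ?andbT; [move=> [-> ->]|move=> /andP[-> ->]].
rewrite tail_dfE /tail_df -tail_cdf.
have -> : 1 - (1 - fine (nu `]1, t]%classic) / c) = fine (nu `]1, t]%classic) / c by ring.
by rewrite mulrC divfK ?gt_eqF// -H fineM// fin_num_measure.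
Qed.

Lemma levy_tailE (t : R) : 1 <= t -> fine (nu `]t, +oo[%classic) = c * tail dF t.
Proof.
move=> t1.
have mt : measurable_fun setT (fun x : R => (\1_(`]t, +oo[ : set R) x : R)%:E).
  by apply/measurable_EFinP; exact: measurable_indic.
have p0 (x : R) : (0 <= (\1_(`]t, +oo[ : set R) x : R)%:E :> \bar R)%E by rewrite lee_fin.
have := tail_df_jump_law _ mt p0; rewrite !integral_indic// setIT.
rewrite (_ : _ `&` _ = `]t, +oo[%classic); last first.
  apply/seteqP; split => x /=; rewrite !in_itv/= !andbT; first by case.
  by move=> tx; split => //; exact: le_lt_trans tx.
by move=> <-; rewrite fineM// fin_num_measure.
Qed.

Lemma tail_df_square_le (e : R) : 0 < e ->
  (forall x : R, 0 < x -> tail_df nu x < 1) ->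
  (1 - self_convolution (tail_df nu) dF x) / (1 - tail_df nu x)
    @[x --> +oo] --> (2 : R) ->
  \forall t \near +oo, tail (convolution dF dF) t <= (2 + e) * tail dF t.
Proof.
move=> e0 F1 /cvgrPdist_le /(_ _ e0) H; near=> t.
have t0 : 0 < t by near: t; apply: nbhs_pinfty_gt; exact: num_real.
have : `|2 - (1 - self_convolution (tail_df nu) dF t) / (1 - tail_df nu t)| <= e.
  by near: t; exact: H.
have -> : 1 - self_convolution (tail_df nu) dF t = tail (convolution dF dF) t.
  rewrite tail_convolution -[X in X - _](Rintegral_probability_cst _ _ dF) /self_convolution.
  rewrite -RintegralB//.
  - by apply: eq_Rintegral => x _; rewrite tail_dfE.
  - by apply: (@integrable_bounded _ _ _ _ _ 1) => // x; rewrite normr1.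
  - have := integrable_tail_shift dF dF t => i1.
    rewrite (_ : _ \o _ = EFin \o (fun x => 1 - tail dF (t - x))).
      apply: (@integrable_bounded _ _ _ _ _ 1).
        apply: measurable_funB => //; apply: measurableT_comp; first exact: measurable_tail.
        exact: measurable_funB.
      move=> x; rewrite ger0_norm ?gerBl ?tail_ge0// subr_ge0; exact: tail_le1.
    by apply/funext => x /=; rewrite tail_dfE subKr.
rewrite -tail_dfE ler_norml => /andP[h _].
rewrite -ler_pdivrMr; first by lra.
by rewrite tail_dfE subr_gt0 F1.
Unshelve. all: by end_near. Qed.

End subexponential_levy.

(** * Two-sided bounds on the distribution of the local time, and the limit *)

Theorem proposition4p1 (R : realType)
    (P : R -> probability (pathspace R) R)
    (S : cumulative R R)
    (m : {measure set R -> \bar R})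
    (p : R -> R -> R -> R)
    (L : R -> pathspace R -> R)
    (nu : {measure set R -> \bar R})
    (HX : recurrent_reflected_diffusion P S m)
    (Hp : transition_density P m p)
    (HL : local_time_at0 P m L)
    (Hnu : inverse_local_time_levy_measure P p L nu)
    (HA : subexponential (tail_df nu))
    (l : R) (hl : 0 < l) :
  fine (P 0 [set w | L t w <= l]) / (l * fine (nu `]t, +oo[%classic))
    @[t --> +oo] --> (1 : R).
Proof.
have lint := levy_int Hnu.
have [F [FE _ F1 Fy Fsub]] := HA.
have c0 := levy_tail1_gt0 nu Fy.
pose c := fine (nu `]1, +oo[%classic).
have F_le0 := tail_df_le0 nu F FE.
have F0 := support_ge0 F F_le0.
have H_gt0 t : 0 < tail F t.
  have [t0|t0] := ltP 0 t; first by rewrite (tail_dfE nu F FE) subr_gt0 F1.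
  by apply: lt_le_trans (tail_nonincreasing F t 0 t0); rewrite tail_eq1.
have H_cvg0 : tail F t @[t --> +oo] --> (0 : R).
  under eq_cvg do rewrite (tail_dfE nu F FE).
  have : 1 - tail_df nu t @[t --> +oo] --> (1 - 1 : R).
    by apply: cvgB; [exact: cvg_cst|exact: Fy].
  by rewrite subrr.
have H_conv e (e0 : 0 < e) := tail_df_square_le nu F FE e e0 F1 Fsub.
have a_ge0 : 0 <= l * c by rewrite mulr_ge0// ltW.
pose a := NngNum a_ge0.
have a0 : 0 < a%:num by rewrite /= mulr_gt0.
have FD := tail_df_jump_law nu F lint FE Fy.
have [Sm [K [Sm0 K0 SmK Slap]]] := levy_approximation nu lint F l a hl erefl F0 FD.
pose M k := convolution (Sm k) (compound_poisson a F).
have M0 k : M k `]-oo, 0[%classic = 0%E.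
  by apply: convolution_neg0 => //; exact: compound_poisson_neg0.
pose tau := inverse_local_time L l.
have Mlap lam : 0 < lam -> fine (exp_integral (M k) (- lam)) @[k --> \oo] -->
    fine (\int[P 0%R]_w expeR (- (lam%:E * tau w)))%E.
  move=> lam0; have := levy_khintchine Hnu (ltW hl) lam0.
  by rewrite /inverse_local_time_laplace => ->; exact: Slap.
have mtau := measurable_inverse_local_time P m L HL l (ltW hl).
have tau0 := inverse_local_time_ge0 L l.
pose f t := fine (P 0 [set w | L t w <= l]).
pose rho t := tail (compound_poisson a F) t.
have fE t : 0 < t -> f t = fine (P 0 [set w | (t%:E <= tau w)%E]).
  by move=> t0; rewrite /f (local_time_le_inverse P m L HL l t (ltW hl) t0).
(* Here k depends on t and on the error e, but neither side of the inequality involves k; it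
   disappears when e is let go to 0. The same holds for [f_le]. *)
have f_ge t : 0 < t -> rho (t + 1) <= f t.
  move=> t0; apply/ler_addgt0Pr => e e0; rewrite fE//.
  have tt : 0 <= t < t + 1 by rewrite ltW//= ltrDl.
  near \oo => k.
  apply: (@le_trans _ _ (tail (M k) (t + 1))); first exact: tail_convolution_ge.
  by near: k; exact: (tail_le_prob_ge _ _ _ _ _ mtau tau0 M0 Mlap _ _ _ tt e0).
have [D D0 HD] := tail_convolution_compound_poisson_upper F a F_le0 H_gt0 H_cvg0 H_conv.
have f_le A t : 0 <= A -> 1 <= t ->
    f t <= rho (t - (1 + A)) + D * K * expR (- A) * tail F (t - 1).
  move=> A0 t1; apply/ler_addgt0Pr => e e0; rewrite fE ?(lt_le_trans ltr01)//.
  have tt : 0 <= t - 1 < t by rewrite subr_ge0 t1/= gtrBl.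
  near \oo => k.
  apply: (@le_trans _ _ (tail (M k) (t - 1) + e)).
    by near: k; exact: (prob_ge_le_tail _ _ _ _ _ mtau tau0 M0 Mlap _ _ _ tt e0).
  by rewrite lerD2r opprD addrA; exact: HD.
apply/cvgrPdist_le => e e0.
(* With h <= 1, the third condition gives (a + 2 h)(1 + h) <= a (1 + e) for the upper bound; the
   fourth gives a (1 - e)(1 + h) <= a - h for the lower one. *)
have [h [h0 h1 he1 he2]] : exists h, [/\ 0 < h, h <= 1, h * (4 + a%:num) <= a%:num * e &
    h * (1 + a%:num) <= a%:num * e].
  have q0 : 0 < a%:num * e / (4 + a%:num) by rewrite divr_gt0 ?mulr_gt0// addr_gt0.
  exists (Num.min 1 (a%:num * e / (4 + a%:num))).
  have hle : Num.min 1 (a%:num * e / (4 + a%:num)) * (4 + a%:num) <= a%:num * e.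
    by rewrite -ler_pdivlMr ?addr_gt0// ge_min lexx orbT.
  have hm : 0 < Num.min 1 (a%:num * e / (4 + a%:num)) by rewrite lt_min ltr01 q0.
  split => //; first by rewrite ge_min lexx.
  by apply: le_trans hle; rewrite ler_wpM2l// ?(ltW hm)//; lra.
(* A is fixed before t goes to infinity, so that the shift by 1 + A is absorbed by
   long-tailedness. *)
have [A A0 DA] : exists2 A, 0 <= A & D * K * expR (- A) <= h.
  have : D * K * expR (- A) @[A --> +oo] --> (D * K * 0 : R).
    by apply: cvgM; [exact: cvg_cst|exact: cvgr_expR].
  rewrite mulr0 => /cvgrPdist_le/(_ _ h0) nA.
  near (pinfty_nbhs R) => A; exists A; first by near: A; apply: nbhs_pinfty_ge; exact: num_real.
  have : `|0 - D * K * expR (- A)| <= h by near: A; exact: nA.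
  by rewrite sub0r normrN; apply: le_trans; exact: ler_norm.
have shiftN (B : R) (Q : R -> Prop) : (\forall t \near +oo, Q t) ->
    \forall t \near +oo, Q (t + B).
  move=> [T [_ TQ]]; exists (T - B); split; first exact: num_real.
  by move=> x Tx; apply: TQ; rewrite -ltrBlDr.
have long s (s0 : 0 <= s) := long_tailed F F_le0 H_gt0 H_cvg0 H_conv s h s0 h0.
have low := tail_compound_poisson_lower F a F_le0 H_gt0 H_cvg0 h h0.
have upp := tail_compound_poisson_upper F a F_le0 H_gt0 H_cvg0 H_conv h h0.
have A1 : 0 <= 1 + A by rewrite addr_ge0.
have long1 := long 1 ler01.
near=> t.
have t1 : 1 <= t by near: t; apply: nbhs_pinfty_ge; exact: num_real.
have t0 : 0 < t by exact: lt_le_trans t1.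
have Ht := H_gt0 t.
have -> : l * fine (nu `]t, +oo[%classic) = a%:num * tail F t.
  by rewrite (levy_tailE nu F lint FE Fy t t1) mulrA.
rewrite -/(f t).
have aH0 : 0 < a%:num * tail F t by rewrite mulr_gt0.
have B1 : tail F (t - 1) <= (1 + h) * tail F t by near: t; exact: long1.
have B2 : tail F (t - (1 + A)) <= (1 + h) * tail F t.
  by near: t; exact: (long _ A1).
have B3 : tail F t <= (1 + h) * tail F (t + 1).
  have : tail F ((t + 1) - 1) <= (1 + h) * tail F (t + 1).
    by near: t; apply: (shiftN 1 (fun t => tail F (t - 1) <= (1 + h) * tail F t)).
  by rewrite addrK.
have B4 : (a%:num - h) * tail F (t + 1) <= rho (t + 1).
  by near: t; apply: (shiftN 1 (fun t => (a%:num - h) * tail F t <= rho t)).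
have B5 : rho (t - (1 + A)) <= (a%:num + h) * tail F (t - (1 + A)).
  by near: t; apply: (shiftN (- (1 + A)) (fun t => rho t <= (a%:num + h) * tail F t)).
have fl := f_ge t t0; have fu := f_le A t A0 t1.
have fu2 : f t <= (a%:num + 2 * h) * (1 + h) * tail F t.
  apply: (le_trans fu).
  have : (a%:num + h) * tail F (t - (1 + A)) <= (a%:num + h) * ((1 + h) * tail F t).
    by rewrite ler_wpM2l// addr_ge0// ltW.
  have : D * K * expR (- A) * tail F (t - 1) <= h * ((1 + h) * tail F t).
    by apply: ler_pM => //; rewrite ?mulr_ge0 ?expR_ge0 ?tail_ge0.
  by lra.
have fl2 : a%:num * (1 - e) * tail F t <= f t.
  (* For e >= 1 the left side is nonpositive; otherwise 1 - e > 0 allows multiplying [B3] by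
     [a * (1 - e)]. *)
  have [e1|e1] := leP 1 e.
    apply: (@le_trans _ _ 0); last exact: fine_ge0.
    by rewrite mulr_le0_ge0 ?tail_ge0// mulr_ge0_le0 ?subr_le0.
  apply: le_trans fl; apply: le_trans B4.
  apply: (@le_trans _ _ (a%:num * (1 - e) * ((1 + h) * tail F (t + 1)))).
    by rewrite ler_wpM2l// mulr_ge0// subr_ge0 ltW.
  rewrite mulrA ler_wpM2r ?tail_ge0//.
  have : 0 <= a%:num * e * h by rewrite !mulr_ge0// ltW.
  by lra.
have fu3 : f t <= a%:num * (1 + e) * tail F t.
  apply: (le_trans fu2); rewrite ler_wpM2r ?tail_ge0//.
  nra.
rewrite distrC ler_norml; apply/andP; split.
  rewrite lerBrDr addrC ler_pdivlMr//; move: fl2; lra.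
rewrite lerBlDr ler_pdivrMr//; move: fu3; lra.
Unshelve. all: by end_near. Qed.
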